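(* Let $G$ be a finite $\partial$-graph such that every component has at least one boundary vertex. The following are equivalent: \begin{enumerate} \item $G$ is completely reducible. \item For every commutative ring $R$, every normalized $R^\times$-network on $G$ is non-degenerate. \item For every commutative ring $R$ and every non-degenerate normalized $R^\times$-network $(G,L)$ on the $\partial$-graph $G$, $\tilde{\Upsilon}(G,L)$ is a free $R$-module. \item There exists an infinite field $F$ such that $\tilde{\Upsilon}(G,\tilde{L}(G,F))$ is a flat $\tilde{R}(G,F)$-module. \item There exists an infinite field $F$ such that every normalized $F^\times$-network on $G$ is non-degenerate. \end{enumerate}
   Context: Graphs are undirected multigraphs with vertex set $V$ and set $E$ of oriented edges (each undirected edge gives $e$ and its reverse $\overline{e}$); $e_+$, $e_-$ are the starting and ending vertices of $e$; $\mathcal{E}(x)=\{e: e_+=x\}$. A $\partial$-graph is a graph with a partition $V=V^\circ\sqcup\partial V$ (interior and boundary vertices). A normalized $R^\times$-network $(G,L)$ is a $\partial$-graph $G$ with a weighted Laplacian $L:RV\to RV$, $Lx=\sum_{e\in\mathcal{E}(x)}w(e)(x-e_-)$, where $w:E\to R^\times$ satisfies $w(\overline{e})=w(e)$. For $u:V\to M$, $Lu(x)=\sum_{e\in\mathcal{E}(x)}w(e)(u(x)-u(e_-))$. For finite $G$, $(G,L)$ is non-degenerate if the only $u:V\to R$ with $u|_{\partial V}\equiv0$ and $Lu\equiv0$ on all of $V$ is $u=0$. With $\epsilon:RV\to R$ the linear map sending each vertex to $1$, $\tilde{\Upsilon}(G,L)=\ker\epsilon/L(RV^\circ)$. For a field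 $F$, $\tilde{R}(G,F)=F[t_e^{\pm1}: e\in E]$ is the Laurent polynomial algebra with $t_e=t_{\overline{e}}$ (one generator per undirected edge), and $\tilde{L}(G,F)$ is the weighted Laplacian over it with $\tilde w(e)=t_e$. Simple layerable extensions: $G'$ is obtained from $G$ by (i) adjoining an isolated boundary vertex $x$ if $V(G')=V(G)\sqcup\{x\}$, $E(G')=E(G)$, $V^\circ(G')=V^\circ(G)$, and $x$ is a boundary vertex of $G'$ with no incident edges; (ii) adjoining a boundary spike $e$ if $V(G')=V(G)\sqcup\{e_+\}$, $E(G')=E(G)\sqcup\{e,\overline{e}\}$, $V^\circ(G')=V^\circ(G)\sqcup\{e_-\}$, where in $G'$ the vertex $e_-$ is interior and $e_+$ is a boundary vertex with no other incident edges (so $e_-\in\partial V(G)$); (iii) adjoining a boundary edge $e$ if $V(G')=V(G)$, $V^\circ(G')=V^\circ(G)$, $E(G')=E(G)\sqcup\{e,\overline{e}\}$ and both endpoints of $e$ are boundary vertices. Given $\partial$-graphs $G_1,G_2$ and $x_i\in\partial V(G_i)$, the boundary wedge-sum $G_1\vee G_2$ is obtained from the disjoint union $G_1\sqcup G_2$ by identifying $x_1$ with $x_2$ (the common vertex being a boundary vertex). Completely reducible finite $\partial$-graphs form the smallest class of finite $\partial$-graphs that contains the empty graph and is closed under layerable extensions (finite sequences of simple layerable extensions), disjoint unions, and boundary wedge-sums. *)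

(* Defs.v *)
From HB Require Import structures.
From mathcomp Require Import all_boot all_algebra.
From mathcomp Require Import boolp classical_sets cardinality.
From mathcomp Require freeg mpoly.

Set Implicit Arguments.
Unset Strict Implicit.
Unset Printing Implicit Defensive.

Import GRing.Theory.
Local Open Scope ring_scope.

(* Oriented edges form the type [edge]; [rev] is fixed-point free, so that     *)
(* each undirected edge (loops included) accounts for two oriented ones.       *)
(* [org e] is e_+ (the starting vertex of e) and [dst e] is e_-.               *)
Record bgraph := BGraph {
  vertex : finType;
  edge : finType;
  org : edge -> vertex;
  dst : edge -> vertex;
  rev : edge -> edge;
  interior : {set vertex};
  revK : involutive rev;
  rev_neq : forall e, rev e != e;
  org_rev : forall e, org (rev e) = dst e
}.

Definition boundary (G : bgraph) : {set vertex G} := ~: interior G.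

Definition adjacent (G : bgraph) : rel (vertex G) :=
  fun x y => [exists e : edge G, (org e == x) && (dst e == y)].

Definition components_meet_boundary (G : bgraph) : Prop :=
  forall x : vertex G,
    exists2 y, y \in boundary G & connect (@adjacent G) x y.

(* The set-theoretic conditions V(G') = V(G) |_| ... are expressed through     *)
(* injections into G', which makes every notion below invariant under          *)
(* isomorphism. [embedding] does not constrain interior vertices.              *)
Record embedding (G G' : bgraph) := Embedding {
  emb_v : vertex G -> vertex G';
  emb_e : edge G -> edge G';
  emb_v_inj : injective emb_v;
  emb_e_inj : injective emb_e;
  emb_org : forall e, org (emb_e e) = emb_v (org e);
  emb_dst : forall e, dst (emb_e e) = emb_v (dst e);
  emb_rev : forall e, rev (emb_e e) = emb_e (rev e)
}.

Definition preserves_interior (G G' : bgraph) (i : embedding G G') : Prop :=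
  forall v, (emb_v i v \in interior G') = (v \in interior G).

Definition adjoins_isolated_vertex (G G' : bgraph) : Prop :=
  exists (i : embedding G G') (x : vertex G'),
    [/\ forall v', v' = x <-> ~ exists v, v' = emb_v i v,
        forall e', exists e, e' = emb_e i e,
        preserves_interior i,
        x \in boundary G'
      & forall e', org e' != x].

Definition adjoins_spike (G G' : bgraph) : Prop :=
  exists (i : embedding G G') (e : edge G') (y : vertex G),
    [/\ forall v', v' = org e <-> ~ exists v, v' = emb_v i v,
        forall e', (e' = e \/ e' = rev e) <-> ~ exists e0, e' = emb_e i e0,
        dst e = emb_v i y /\ y \in boundary G,
        forall v, (emb_v i v \in interior G') = (v \in interior G) || (v == y)
      & org e \in boundary G'].

Definition adjoins_boundary_edge (G G' : bgraph) : Prop :=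
  exists (i : embedding G G') (e : edge G'),
    [/\ forall v', exists v, v' = emb_v i v,
        forall e', (e' = e \/ e' = rev e) <-> ~ exists e0, e' = emb_e i e0,
        preserves_interior i
      & org e \in boundary G' /\ dst e \in boundary G'].

Inductive layerable_extension (G : bgraph) : bgraph -> Prop :=
| layerable_refl : layerable_extension G G
| layerable_step G1 G2 :
    layerable_extension G G1 ->
    adjoins_isolated_vertex G1 G2 \/ adjoins_spike G1 G2
      \/ adjoins_boundary_edge G1 G2 ->
    layerable_extension G G2.

Definition is_disjoint_union (G1 G2 G : bgraph) : Prop :=
  exists (i1 : embedding G1 G) (i2 : embedding G2 G),
    [/\ preserves_interior i1 /\ preserves_interior i2,
        forall v, (exists v1, v = emb_v i1 v1) \/ (exists v2, v = emb_v i2 v2),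
        forall v1 v2, emb_v i1 v1 <> emb_v i2 v2,
        forall e, (exists e1, e = emb_e i1 e1) \/ (exists e2, e = emb_e i2 e2)
      & forall e1 e2, emb_e i1 e1 <> emb_e i2 e2].

Definition is_boundary_wedge_sum (G1 G2 G : bgraph) : Prop :=
  exists (x1 : vertex G1) (x2 : vertex G2)
         (i1 : embedding G1 G) (i2 : embedding G2 G),
    [/\ x1 \in boundary G1 /\ x2 \in boundary G2,
        preserves_interior i1 /\ preserves_interior i2,
        (forall v, (exists v1, v = emb_v i1 v1) \/
                   (exists v2, v = emb_v i2 v2)) /\
        (forall v1 v2, emb_v i1 v1 = emb_v i2 v2 <-> v1 = x1 /\ v2 = x2),
        forall e, (exists e1, e = emb_e i1 e1) \/ (exists e2, e = emb_e i2 e2)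
      & forall e1 e2, emb_e i1 e1 <> emb_e i2 e2].

Inductive completely_reducible : bgraph -> Prop :=
| CR_empty G : #|vertex G| = 0%N -> completely_reducible G
| CR_layerable G G' :
    completely_reducible G -> layerable_extension G G' ->
    completely_reducible G'
| CR_disjoint_union G1 G2 G :
    completely_reducible G1 -> completely_reducible G2 ->
    is_disjoint_union G1 G2 G -> completely_reducible G
| CR_boundary_wedge_sum G1 G2 G :
    completely_reducible G1 -> completely_reducible G2 ->
    is_boundary_wedge_sum G1 G2 G -> completely_reducible G.

Section QuotientModule.
Variables (R : pzRingType) (M : lmodType R) (N : submodClosed M).

Definition zmod_of_submod : {pred M} := fun x => x \in N.

Lemma zmod_of_submod_closed : zmod_closed zmod_of_submod.
Proof. exact: GRing.submod_closedB (GRing.submodClosedP N). Qed.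

HB.instance Definition _ :=
  GRing.isZmodClosed.Build M zmod_of_submod zmod_of_submod_closed.

Definition quotmod : Type := Quotient.quot zmod_of_submod.
HB.instance Definition _ := GRing.Zmodule.on quotmod.

Definition quotmod_pi (x : M) : quotmod := \pi_(Quotient.quot zmod_of_submod)%qT x.

Definition quotmod_repr (q : quotmod) : M :=
  repr (q : Quotient.quot zmod_of_submod).

Definition quotmod_scale (a : R) (q : quotmod) : quotmod :=
  quotmod_pi (a *: quotmod_repr q).

Lemma quotmod_pi_eq x y : (quotmod_pi x = quotmod_pi y) <-> (x - y \in N).
Proof.
have -> : (x - y \in N) = (quotmod_pi x == quotmod_pi y).
  exact: (Quotient.idealrBE zmod_of_submod x y).
by split=> /eqP.
Qed.

Lemma quotmod_piD x y : quotmod_pi (x + y) = quotmod_pi x + quotmod_pi y.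
Proof. exact: (raddfD \pi_(Quotient.quot zmod_of_submod)%qT). Qed.

Lemma quotmod_piK (q : quotmod) : quotmod_pi (quotmod_repr q) = q.
Proof. exact: reprK. Qed.

Lemma quotmod_piZ a x : quotmod_pi (a *: x) = quotmod_scale a (quotmod_pi x).
Proof.
apply/quotmod_pi_eq; rewrite -scalerBr rpredZ //.
by apply/quotmod_pi_eq; rewrite quotmod_piK.
Qed.

Lemma quotmod_scaleA a b q :
  quotmod_scale a (quotmod_scale b q) = quotmod_scale (a * b) q.
Proof. by rewrite -[q]quotmod_piK -!quotmod_piZ scalerA. Qed.

Lemma quotmod_scale1 : left_id 1 quotmod_scale.
Proof. by move=> q; rewrite -[q]quotmod_piK -!quotmod_piZ scale1r. Qed.

Lemma quotmod_scaleDr : right_distributive quotmod_scale +%R.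
Proof.
move=> a q r; rewrite -[q]quotmod_piK -[r]quotmod_piK.
by rewrite -quotmod_piD -!quotmod_piZ scalerDr quotmod_piD.
Qed.

Lemma quotmod_scaleDl q : {morph quotmod_scale^~ q : a b / a + b}.
Proof.
by move=> a b; rewrite -[q]quotmod_piK -!quotmod_piZ scalerDl quotmod_piD.
Qed.

HB.instance Definition _ := GRing.Zmodule_isLmodule.Build R quotmod
  quotmod_scaleA quotmod_scale1 quotmod_scaleDr quotmod_scaleDl.

Lemma quotmod_pi_is_linear : linear quotmod_pi.
Proof. by move=> a x y; rewrite quotmod_piD quotmod_piZ. Qed.

HB.instance Definition _ :=
  GRing.isLinear.Build R M quotmod *:%R quotmod_pi quotmod_pi_is_linear.

End QuotientModule.

Section Span.
Variables (R : pzRingType) (M : lmodType R) (S : M -> Prop).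

Inductive spanned : M -> Prop :=
| spanned0 : spanned 0
| spannedD a x y : S x -> spanned y -> spanned (a *: x + y).

Definition span : {pred M} := fun x => `[< spanned x >].

Lemma span_closed : submod_closed span.
Proof.
split=> [|a x y /asboolP hx /asboolP hy]; apply/asboolP; first exact: spanned0.
elim: hx => [|b x' y' hx' _ IH]; first by rewrite scaler0 add0r.
by rewrite scalerDr scalerA -addrA; apply: spannedD.
Qed.

HB.instance Definition _ := GRing.isSubmodClosed.Build R M span span_closed.

End Span.

Definition free_module (R : pzRingType) (M : lmodType R) : Prop :=
  exists B : M -> Prop,
    (forall x, x \in span B) /\
    (forall (s : seq M) (c : M -> R),
        uniq s -> (forall b, b \in s -> B b) ->
        \sum_(b <- s) c b *: b = 0 -> forall b, b \in s -> c b = 0).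

Section TensorProduct.
Import freeg.
Variable R : comNzRingType.

Section Def.
Variables A M : lmodType R.

Let F : lmodType R := {freeg (A * M)%type / R}.
Let gen (a : A) (m : M) : F := << (a, m) >>.

Inductive tensor_relation : F -> Prop :=
| tensor_relDl a a' m : tensor_relation (gen (a + a') m - (gen a m + gen a' m))
| tensor_relDr a m m' : tensor_relation (gen a (m + m') - (gen a m + gen a m'))
| tensor_relZl r a m : tensor_relation (gen (r *: a) m - r *: gen a m)
| tensor_relZr r a m : tensor_relation (gen a (r *: m) - r *: gen a m).

Definition tensor : lmodType R := quotmod (span tensor_relation).

Definition tensor_pi (x : F) : tensor := quotmod_pi (span tensor_relation) x.

Definition tensor_repr (t : tensor) : F := quotmod_repr t.

Definition tensor_pure (a : A) (m : M) : tensor := tensor_pi (gen a m).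

End Def.

Section Map.
Variables (A B M : lmodType R) (f : {linear A -> B}).

Definition freeg_map (x : {freeg (A * M)%type / R}) :
    {freeg (B * M)%type / R} :=
  fglift (fun p : A * M => << (f p.1, p.2) >> : {freeg (B * M)%type / R}) x.

(* The map f (x) id_M; by [tensor_mapE] it does not depend on representatives. *)
Definition tensor_map (t : tensor A M) : tensor B M :=
  tensor_pi (freeg_map (tensor_repr t)).

Lemma freeg_map_is_zmod_morphism : zmod_morphism freeg_map.
Proof. exact: lift_is_additive. Qed.

HB.instance Definition _ := GRing.isZmodMorphism.Build _ _ freeg_map
  freeg_map_is_zmod_morphism.

Lemma freeg_map_is_scalable : scalable freeg_map.
Proof.
have fS (s : seq (A * M)) (c : A * M -> R) :
    freeg_map (\sum_(z <- s) << c z *g z >>) =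
    \sum_(z <- s) c z *: (<< (f z.1, z.2) >> : {freeg (B * M)%type / R}).
  by rewrite raddf_sum; apply: eq_bigr => z _; exact: liftU.
move=> r x; rewrite -[in RHS](freeg_sumE x) -[r *: x]/(fgscale r x) /fgscale.
by rewrite !fS scaler_sumr; apply: eq_bigr => z _; rewrite scalerA.
Qed.

HB.instance Definition _ := GRing.isScalable.Build R _ _ *:%R freeg_map
  freeg_map_is_scalable.

Lemma freeg_mapU a m : freeg_map << (a, m) >> = << (f a, m) >>.
Proof. by rewrite /freeg_map liftU scale1r. Qed.

Lemma tensor_mapE x : tensor_map (tensor_pi x) = tensor_pi (freeg_map x).
Proof.
apply/quotmod_pi_eq; rewrite -linearB.
have: tensor_repr (tensor_pi x) - x \in span (@tensor_relation A M).
  by apply/quotmod_pi_eq; rewrite quotmod_piK.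
move/asboolP; elim=> [|r _ y [a a' m|a m m'|s a m|s a m] _ IH];
  first by rewrite linear0 rpred0.
all: rewrite linearP rpredD //; apply: rpredZ; apply/asboolP.
all: rewrite -[X in spanned _ X]scale1r -[X in spanned _ X]addr0.
all: apply: spannedD; last exact: spanned0.
- rewrite linearB linearD /= !freeg_mapU (linearD f); exact: tensor_relDl.
- rewrite linearB linearD /= !freeg_mapU; exact: tensor_relDr.
- rewrite linearB linearZ /= !freeg_mapU linearZ; exact: tensor_relZl.
- rewrite linearB linearZ /= !freeg_mapU; exact: tensor_relZr.
Qed.

Lemma tensor_map_pure a m :
  tensor_map (tensor_pure a m) = tensor_pure (f a) m.
Proof. by rewrite tensor_mapE freeg_mapU. Qed.

End Map.

Definition flat_module (M : lmodType R) : Prop :=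
  forall (A B : lmodType R) (f : {linear A -> B}),
    injective f -> injective (@tensor_map A B M f).

End TensorProduct.

Section Networks.
Variables (G : bgraph) (R : comPzRingType).

(* [comPzRingType] includes the zero ring and carries no unit predicate, hence  *)
(* the explicit inverse in [weight_unit].                                      *)
Record network := Network {
  weight :> edge G -> R;
  weight_unit : forall e, exists v, v * weight e = 1;
  weight_rev : forall e, weight (rev e) = weight e
}.

(* R V as the module of functions V -> R, V being finite.                      *)
Definition chain : lmodType R := {ffun vertex G -> R^o}.

Definition delta (x : vertex G) : chain := [ffun y => (y == x)%:R].

Definition augmentation (c : chain) : R := \sum_x c x.

Lemma augmentation_is_linear : linear_for *%R augmentation.
Proof.
move=> a c d; rewrite /augmentation mulr_sumr -big_split /=.
by apply: eq_bigr => x _; rewrite !ffunE.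
Qed.

HB.instance Definition _ := GRing.isLinear.Build R chain R *%R augmentation
  augmentation_is_linear.

Definition in_ker_augmentation : {pred chain} :=
  fun c => augmentation c == 0.

Lemma ker_augmentation_closed : submod_closed in_ker_augmentation.
Proof.
split=> [|a c d]; rewrite !unfold_in ?linear0 // => /eqP hc /eqP hd.
by rewrite linearP /= hc hd mulr0 addr0.
Qed.

HB.instance Definition _ := GRing.isSubmodClosed.Build R chain
  in_ker_augmentation ker_augmentation_closed.

Definition ker_augmentation := {c : chain | c \in in_ker_augmentation}.
HB.instance Definition _ := SubChoice.on ker_augmentation.
HB.instance Definition _ :=
  [SubChoice_isSubZmodule of ker_augmentation by <:].
HB.instance Definition _ :=
  [SubZmodule_isSubLmodule of ker_augmentation by <:].

Section Laplacian.
Variable w : network.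

Definition laplacian (c : chain) : chain :=
  \sum_x c x *: (\sum_(e | org e == x) w e *: (delta x - delta (dst e))).

Definition laplacian_fun (u : vertex G -> R) (x : vertex G) : R :=
  \sum_(e | org e == x) w e * (u x - u (dst e)).

Definition non_degenerate : Prop :=
  forall u : vertex G -> R,
    (forall x, x \in boundary G -> u x = 0) ->
    (forall x, laplacian_fun u x = 0) ->
    forall x, u x = 0.

Lemma laplacian_is_linear : linear laplacian.
Proof.
move=> a c d; rewrite /laplacian scaler_sumr -big_split /=.
by apply: eq_bigr => x _; rewrite !ffunE scalerDl scalerA.
Qed.

HB.instance Definition _ := GRing.isLinear.Build R chain chain *:%R laplacian
  laplacian_is_linear.

Definition interior_chain (c : chain) : Prop :=
  forall x, x \notin interior G -> c x = 0.

Definition in_laplacian_interior : {pred ker_augmentation} :=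
  fun k => `[< exists2 c, interior_chain c & val k = laplacian c >].

Lemma laplacian_interior_closed : submod_closed in_laplacian_interior.
Proof.
split=> [|a k l /asboolP[c ic kc] /asboolP[d id_ ld]]; apply/asboolP.
  exists 0; last by rewrite !linear0.
  by move=> x _; rewrite ffunE.
exists (a *: c + d); last by rewrite !linearP /= kc ld.
by move=> x xi; rewrite !ffunE ic // id_ // scaler0 addr0.
Qed.

HB.instance Definition _ := GRing.isSubmodClosed.Build R ker_augmentation
  in_laplacian_interior laplacian_interior_closed.

Definition upsilon : lmodType R := quotmod in_laplacian_interior.

End Laplacian.
End Networks.

Section Laurent.
Import mpoly.
Local Notation "x %:F" := (FracField.tofrac x).
Variable F : fieldType.

Section Ring.
Variable n : nat.

(* F[t_1^{+-1}, ..., t_n^{+-1}], as the ring of fractions with monomial        *)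
(* denominators inside F(t_1, ..., t_n).                                       *)
Definition is_laurent : {pred {fraction {mpoly F[n]}}} :=
  fun x => `[< exists (p : {mpoly F[n]}) (m : 'X_{1..n}),
                 x = p%:F / ('X_[m] : {mpoly F[n]})%:F >].

Lemma mpolyX_frac_neq0 (m : 'X_{1..n}) :
  ('X_[m] : {mpoly F[n]})%:F != 0.
Proof.
rewrite tofrac_eq0; apply/eqP => /(congr1 (mcoeff m)) /eqP.
by rewrite mcoeffX eqxx mcoeff0 oner_eq0.
Qed.

Lemma is_laurent_closed : subring_closed is_laurent.
Proof.
split=> [|x y|x y].
- apply/asboolP; exists 1, 0%MM; by rewrite mpolyX0 tofrac1 divr1.
- move=> /asboolP[p [m ->]] /asboolP[q [k ->]]; apply/asboolP.
  exists (p * 'X_[k] - q * 'X_[m]), (m + k)%MM.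
  rewrite mpolyXD tofracB !tofracM -mulNr addf_div ?mpolyX_frac_neq0 //.
  by rewrite mulNr.
- move=> /asboolP[p [m ->]] /asboolP[q [k ->]]; apply/asboolP.
  by exists (p * q), (m + k)%MM; rewrite mpolyXD !tofracM mulf_div.
Qed.

HB.instance Definition _ := GRing.isSubringClosed.Build
  {fraction {mpoly F[n]}} is_laurent is_laurent_closed.

Definition laurent := {x : {fraction {mpoly F[n]}} | x \in is_laurent}.
HB.instance Definition _ := SubChoice.on laurent.
HB.instance Definition _ := [SubChoice_isSubComNzRing of laurent by <:].

Lemma laurent_var_subproof (i : 'I_n) :
  ('X_i : {mpoly F[n]})%:F \in is_laurent.
Proof.
by apply/asboolP; exists 'X_i, 0%MM; rewrite mpolyX0 tofrac1 divr1.
Qed.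

Lemma laurent_varV_subproof (i : 'I_n) :
  (('X_i : {mpoly F[n]})%:F)^-1 \in is_laurent.
Proof. by apply/asboolP; exists 1, U_(i)%MM; rewrite tofrac1 mul1r. Qed.

Definition laurent_var (i : 'I_n) : laurent :=
  exist (fun x => x \in is_laurent) _ (laurent_var_subproof i).

Lemma laurent_var_unit (i : 'I_n) : exists v, v * laurent_var i = 1.
Proof.
exists (exist (fun x => x \in is_laurent) _ (laurent_varV_subproof i)).
apply: val_inj.
by rewrite rmorphM rmorph1 /= mulVf // mpolyX_frac_neq0.
Qed.

End Ring.

Variable G : bgraph.

Definition uedge (e : edge G) : {set edge G} := [set e; rev e]%SET.

Definition uedges : {set {set edge G}} := [set uedge e | e : edge G]%SET.

Lemma uedge_in (e : edge G) : uedge e \in uedges.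
Proof. exact: imset_f. Qed.

Definition laurent_ring : comNzRingType := laurent #|uedges|.

Definition laurent_weight (e : edge G) : laurent_ring :=
  laurent_var (enum_rank_in (uedge_in e) (uedge e)).

Lemma laurent_weight_unit e : exists v, v * laurent_weight e = 1.
Proof. exact: laurent_var_unit. Qed.

Lemma laurent_weight_rev e : laurent_weight (rev e) = laurent_weight e.
Proof.
congr laurent_var; apply: enum_val_inj.
by rewrite !enum_rankK_in ?uedge_in // /uedge revK finset.setUC.
Qed.

Definition laurent_network : network G laurent_ring :=
  Network laurent_weight_unit laurent_weight_rev.

End Laurent.

(* Main.v *)
Require Import Defs.
From HB Require Import structures.
From mathcomp Require Import freeg mpoly.
From mathcomp Require Import all_boot all_algebra.
From mathcomp Require Import boolp classical_sets cardinality.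
From mathcomp Require Import ring.
(* Makes [rev] the reversal of edges again, rather than that of sequences. *)
Import Defs.

Set Implicit Arguments.
Unset Strict Implicit.
Unset Printing Implicit Defensive.

Import GRing.Theory.
Local Open Scope ring_scope.

(** With the five statements numbered in order, the implications proved are
    (1) => (2) => (3) => (4) => (5) => (1), the step (2) => (3) passing through
    (1) again: (2) contains (5) over the rational numbers, and (1) implies (3).

    (1) => (2) ([completely_reducible_non_degenerate]).  A harmonic function
    vanishing on the boundary is propagated along the construction of the graph:
    it vanishes at both ends of a boundary edge, the equation at the tip of a
    spike makes it vanish at the new interior vertex, and in a wedge-sum the
    Laplacian of each half vanishes at the common vertex because the values of a
    Laplacian sum to zero.

    (1) => (3) ([completely_reducible_kernel_dual_bases],
    [kernel_dual_bases_free]).  Freeness of the quotient ker eps / L(R V^o) is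
    recorded by an explicit pair of dual families: chains b_i of augmentation
    zero and functions phi_i harmonic on the interior with <phi_i, b_j> equal to
    delta_ij, such that every k in ker eps differs from sum_i <phi_i, k> b_i by
    the Laplacian of an interior chain.  Such data are carried along each
    construction step.

    (3) => (4) ([laurent_non_degenerate], [free_flat]).  Free modules are flat,
    and the network with generic weights is non-degenerate: the determinant of
    its Dirichlet problem is a polynomial in the weights, which does not vanish
    at the indicator function of a spanning forest rooted on the boundary.

    (4) => (5) ([flat_laurent_non_degenerate]).  Given weights w and a harmonic u
    over F vanishing on the boundary, regard u as a chain with constant
    coefficients in the Laurent ring.  Its generic Laplacian has coefficients in
    the ideal m of elements vanishing at w.  Flatness, applied to the inclusion
    of m in the ring, shows that it is the generic Laplacian of an interior chain
    with coefficients in m ([flat_ideal_laplacian]); by generic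
    non-degeneracy that chain is u, so the constants u(x) lie in m and are zero.

    (5) => (1) ([always_non_degenerate_reducible]).  By induction on the size,
    one removes an edge between boundary vertices, or splits the graph at a
    bridge with an end on the boundary into a wedge-sum of which one summand is a
    spike attached to a smaller graph.  If neither exists and there is an
    interior vertex, a degenerate network is built: take a potential u that is
    zero on the boundary, nonzero on the interior, and whose values at the ends
    of an edge agree only for bridges and loops; take a flow g that is nonzero
    on every edge that is not a bridge; then the weights g(e) / (u(e_+) - u(e_-)),
    replaced by 1 when the denominator is zero, make u harmonic
    ([degenerate_network]).  If there is no interior vertex either, the graph
    consists of isolated boundary vertices. *)

(** * The Laplacian on functions *)

(** Reindexing along an injection whose image contains the support. *)
Lemma sum_inj (I J : finType) (M : nmodType) (h : I -> J) (P : pred J)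
    (F : J -> M) :
  injective h -> (forall j, P j -> (forall i, j <> h i) -> F j = 0) ->
  \sum_(j | P j) F j = \sum_(i | P (h i)) F (h i).
Proof.
move=> hI F0; rewrite (bigID (fun j => j \in codom h)) /= [X in _ + X]big1.
  rewrite addr0 -(big_imset F (A := [pred i | P (h i)])) /=; last by move=> ? ? _ _ /hI.
  apply: eq_bigl => j; apply/andP/imsetP => [[Pj /codomP[i eji]]|[i Pi ->]].
    by exists i => //; rewrite inE -eji.
  by rewrite inE in Pi; split=> //; exact: codom_f.
move=> j /andP[Pj jh]; apply: F0 => // i eji.
by rewrite eji codom_f in jh.
Qed.

Section Laplacian.
Variables (G : bgraph) (R : comPzRingType) (w : network G R).
Implicit Types (u k c f : vertex G -> R).

Lemma dst_rev (e : edge G) : dst (rev e) = org e.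
Proof. by rewrite -org_rev revK. Qed.

Lemma eq_laplacian_fun u f : u =1 f -> laplacian_fun w u =1 laplacian_fun w f.
Proof. by move=> uf x; apply: eq_bigr => e _; rewrite !uf. Qed.

Lemma laplacian_funD u f x :
  laplacian_fun w (fun y => u y + f y) x
    = laplacian_fun w u x + laplacian_fun w f x.
Proof.
rewrite -big_split; apply: eq_bigr => e _ /=.
by rewrite -mulrDr opprD addrACA.
Qed.

Lemma laplacian_funZ r u x :
  laplacian_fun w (fun y => r * u y) x = r * laplacian_fun w u x.
Proof. by rewrite mulr_sumr; apply: eq_bigr => e _; rewrite -mulrBr mulrCA. Qed.

Lemma laplacian_fun_eq0 u x :
  (forall e, org e = x -> u x = u (dst e)) -> laplacian_fun w u x = 0.
Proof.
by move=> ux; rewrite /laplacian_fun big1 // => e /eqP/ux->; rewrite subrr mulr0.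
Qed.

Lemma laplacian_fun_cst r x : laplacian_fun w (fun=> r) x = 0.
Proof. exact: laplacian_fun_eq0. Qed.

Lemma sum_edge_org (F : vertex G -> edge G -> R) :
  \sum_x \sum_(e | org e == x) F x e = \sum_e F (org e) e.
Proof.
rewrite (exchange_big_dep xpredT) //=; apply: eq_bigr => e _.
by rewrite (eq_bigl (pred1 (org e))) ?big_pred1_eq // => x; rewrite eq_sym.
Qed.

Lemma rev_bij : bijective (@rev G).
Proof. exact: inv_bij (@revK G). Qed.

Lemma sum_edge_rev (F : edge G -> R) : \sum_e F (rev e) = \sum_e F e.
Proof. by rewrite [RHS](reindex (@rev G)) //; apply/onW_bij/rev_bij. Qed.

(** No factor 2 intervenes: both sides are sums over oriented edges, matched by
    reversal, so the identity holds in every characteristic. *)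
Lemma laplacian_selfadj u f :
  \sum_x u x * laplacian_fun w f x = \sum_x laplacian_fun w u x * f x.
Proof.
under eq_bigr do rewrite mulr_sumr; under [RHS]eq_bigr do rewrite mulr_suml.
rewrite !sum_edge_org.
have -> : \sum_e u (org e) * (w e * (f (org e) - f (dst e))) =
  \sum_e w e * u (org e) * f (org e) - \sum_e w e * u (org e) * f (dst e).
  by rewrite -sumrB; apply: eq_bigr => e _; rewrite -mulrBr mulrA [u _ * _]mulrC.
have -> : \sum_e w e * (u (org e) - u (dst e)) * f (org e) =
  \sum_e w e * u (org e) * f (org e) - \sum_e w e * u (dst e) * f (org e).
  by rewrite -sumrB; apply: eq_bigr => e _; rewrite mulrBr mulrBl.
congr (_ - _); rewrite -sum_edge_rev; apply: eq_bigr => e _.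
by rewrite weight_rev org_rev dst_rev.
Qed.

Lemma sum_laplacian_fun u : \sum_x laplacian_fun w u x = 0.
Proof.
have := laplacian_selfadj (fun=> 1) u.
under eq_bigr do rewrite mul1r; move=> ->.
by rewrite big1 // => x _; rewrite laplacian_fun_cst mul0r.
Qed.

(** The Laplacian of a chain and that of a function are given by the same
    coefficients, the weights being symmetric. *)
Lemma laplacianE (c : chain G R) (y : vertex G) :
  laplacian w c y = laplacian_fun w c y.
Proof.
rewrite /laplacian sum_ffunE.
have -> : \sum_i (c i *: (\sum_(e | org e == i) w e *: (delta R i - delta R (dst e)))) y
  = \sum_i c i * laplacian_fun w (fun x => (x == y)%:R) i.
  apply: eq_bigr => x _; rewrite ffunE sum_ffunE; congr (_ * _).
  by apply: eq_bigr => e _; rewrite !ffunE [y == x]eq_sym [y == dst e]eq_sym.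
rewrite laplacian_selfadj (bigD1 y) //= eqxx mulr1 big1 ?addr0 //.
by move=> x /negbTE->; rewrite mulr0.
Qed.

Lemma laplacian_interior_inj (c d : chain G R) : non_degenerate w ->
  interior_chain c -> interior_chain d -> laplacian w c = laplacian w d -> c = d.
Proof.
move=> nd ic id cd; apply/ffunP => x; apply/eqP; rewrite -subr_eq0; apply/eqP.
move: x; apply: (nd (fun x => c x - d x)) => x.
  by rewrite finset.in_setC => xb; rewrite ic // id // subrr.
rewrite (laplacian_funD c (fun x => - d x)).
have -> : laplacian_fun w (fun x => - d x) x = - laplacian_fun w d x.
  by rewrite -mulN1r -laplacian_funZ; apply: eq_laplacian_fun => z; rewrite mulN1r.
by rewrite -!laplacianE cd subrr.
Qed.

End Laplacian.

(** * Embeddings of networks *)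

Section Embedding.
Variables (G1 G : bgraph) (i : embedding G1 G) (R : comPzRingType).
Variable w : network G R.

(** The restriction of a network along an embedding. *)
Definition pull_weight (e : edge G1) : R := w (emb_e i e).

Lemma pull_weight_unit e : exists v, v * pull_weight e = 1.
Proof. exact: weight_unit. Qed.

Lemma pull_weight_rev e : pull_weight (rev e) = pull_weight e.
Proof. by rewrite /pull_weight -emb_rev weight_rev. Qed.

Definition pull_network : network G1 R :=
  Network pull_weight_unit pull_weight_rev.

(** Extension by zero of a function along an embedding. *)
Definition push (f : vertex G1 -> R) (v : vertex G) : R :=
  \sum_(v1 | emb_v i v1 == v) f v1.

(** An embedding that maps interior vertices to interior vertices, and whose image
    contains every edge at such a vertex; the Laplacian at an interior vertex is
    then the same in both networks. *)
Definition open_embedding : Prop :=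
  (forall v, v \in interior G1 -> emb_v i v \in interior G) /\
  (forall e', (forall e, e' <> emb_e i e) ->
    forall v, v \in interior G1 -> org e' <> emb_v i v).

Lemma push_emb f v : push f (emb_v i v) = f v.
Proof.
rewrite /push (eq_bigl (pred1 v)) ?big_pred1_eq // => v1.
by rewrite /= (inj_eq (@emb_v_inj _ _ i)).
Qed.

Lemma push_out f v : (forall v1, v <> emb_v i v1) -> push f v = 0.
Proof. by move=> vi; rewrite /push big1 // => v1 /eqP/esym/vi. Qed.

Lemma emb_vP v : (exists v1, v = emb_v i v1) \/ (forall v1, v <> emb_v i v1).
Proof.
have [[v1 ->]|nv] := pselect (exists v1, v = emb_v i v1).
  by left; exists v1.
by right=> v1 vv; apply: nv; exists v1.
Qed.

Lemma emb_eP e : (exists e1, e = emb_e i e1) \/ (forall e1, e <> emb_e i e1).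
Proof.
have [[v1 ->]|nv] := pselect (exists v1, e = emb_e i v1).
  by left; exists v1.
by right=> v1 vv; apply: nv; exists v1.
Qed.

Lemma pushD f g v : push (fun x => f x + g x) v = push f v + push g v.
Proof. exact: big_split. Qed.

Lemma sum_push f k : \sum_v f v * push k v = \sum_v1 f (emb_v i v1) * k v1.
Proof.
rewrite (sum_inj (h := emb_v i)); last first.
- by move=> v _ vi; rewrite push_out ?mulr0.
- exact: emb_v_inj.
by apply: eq_bigr => v _; rewrite push_emb.
Qed.

(** Edges outside the image do not matter when [u] takes the same value at both
    of their ends. *)
Lemma laplacian_fun_pull_at u v :
  (forall e', (forall e, e' <> emb_e i e) -> org e' = emb_v i v ->
    u (emb_v i v) = u (dst e')) ->
  laplacian_fun w u (emb_v i v)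
    = laplacian_fun pull_network (fun x => u (emb_v i x)) v.
Proof.
move=> uv; rewrite /laplacian_fun (sum_inj (h := emb_e i)); last first.
- by move=> e /eqP oe ei; rewrite (uv e) // subrr mulr0.
- exact: emb_e_inj.
apply: eq_big => e; first by rewrite emb_org (inj_eq (@emb_v_inj _ _ i)).
by rewrite emb_dst.
Qed.

Hypothesis io : open_embedding.

Lemma laplacian_fun_pull u v : v \in interior G1 ->
  laplacian_fun w u (emb_v i v)
    = laplacian_fun pull_network (fun x => u (emb_v i x)) v.
Proof.
by move=> vi; apply: laplacian_fun_pull_at => e' ei oe; case: (io.2 _ ei _ vi).
Qed.

Lemma laplacian_fun_push c x : (forall v, v \notin interior G1 -> c v = 0) ->
  laplacian_fun w (push c) x = push (laplacian_fun pull_network c) x.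
Proof.
move=> c0.
have pc0 e' : (forall e, e' <> emb_e i e) -> push c (org e') = 0.
  move=> ei; have [[v ev]|] := emb_vP (org e'); last exact: push_out.
  rewrite ev push_emb c0 //; apply/negP => vi; exact: (io.2 _ ei _ vi).
have pc0' e' : (forall e, e' <> emb_e i e) -> push c (dst e') = 0.
  move=> ei; rewrite -org_rev pc0 // => e ee; apply: (ei (rev e)).
  by rewrite -emb_rev -ee revK.
rewrite {1}/laplacian_fun (sum_inj (h := emb_e i)); last first.
- by move=> e /eqP oe ei; rewrite -oe pc0 // pc0' // subrr mulr0.
- exact: emb_e_inj.
have [[v ->]|nv] := emb_vP x.
  rewrite !push_emb /laplacian_fun; apply: eq_big => e.
    by rewrite emb_org (inj_eq (@emb_v_inj _ _ i)).
  by rewrite emb_dst push_emb.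
by rewrite [RHS]push_out // big1 // => e /eqP oe; case: (nv (org e)); rewrite -emb_org.
Qed.

End Embedding.

(** * Completely reducible graphs are non-degenerate *)

Definition no_edge (e : void) : unit := match e with end.

Lemma no_edge_revK : involutive (@id void). Proof. by []. Qed.
Lemma no_edge_rev_neq (e : void) : id e != e. Proof. by case: e. Qed.
Lemma no_edge_org (e : void) : no_edge (id e) = no_edge e. Proof. by []. Qed.

(** The graph with a single vertex, on the boundary, and no edge. *)
Definition point : bgraph :=
  BGraph finset.set0 no_edge_revK no_edge_rev_neq no_edge_org.

Lemma boundaryE (G : bgraph) (x : vertex G) :
  (x \in boundary G) = (x \notin interior G).
Proof. by rewrite finset.in_setC. Qed.

(** Adjoining an isolated boundary vertex is a special case of a disjoint union. *)
Lemma isolated_vertex_disjoint_union (G G' : bgraph) :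
  adjoins_isolated_vertex G G' -> is_disjoint_union G point G'.
Proof.
case=> i [x [xP eP iP xb xe]].
have inj_v : injective (fun _ : vertex point => x) by case=> [] [].
have inj_e : injective (fun e : edge point => match e return edge G' with end) by case.
exists i, (@Embedding point G' _ _ inj_v inj_e
  (fun e => match e with end) (fun e => match e with end) (fun e => match e with end)).
split=> /=.
- split=> // v; rewrite /= finset.in_set0.
  by apply/negbTE; rewrite -boundaryE.
- move=> v; have [|] := emb_vP i v; first by left.
  by move=> vi; right; exists tt; apply/xP => -[v0 /vi].
- by move=> v _ ev; case: ((xP x).1 erefl); exists v.
- by move=> e; left; exact: eP.
- by move=> e [].
Qed.

Lemma completely_reducible_induction (P : bgraph -> Prop) :
  (forall G, #|vertex G| = 0%N -> P G) -> P point ->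
  (forall G G', P G -> adjoins_spike G G' -> P G') ->
  (forall G G', P G -> adjoins_boundary_edge G G' -> P G') ->
  (forall G1 G2 G, P G1 -> P G2 -> is_disjoint_union G1 G2 G -> P G) ->
  (forall G1 G2 G, P G1 -> P G2 -> is_boundary_wedge_sum G1 G2 G -> P G) ->
  forall G, completely_reducible G -> P G.
Proof.
move=> P0 Ppt Psp Pbe Pdu Pws G; elim=> {G}.
- exact: P0.
- move=> G G' _ PG; elim=> // G1 G2 _ PG1 [|[]].
  + by move=> /isolated_vertex_disjoint_union; apply: Pdu.
  + exact: Psp.
  + exact: Pbe.
- by move=> G1 G2 G _ P1 _ P2; apply: Pdu.
- by move=> G1 G2 G _ P1 _ P2; apply: Pws.
Qed.

Lemma disjoint_union_org (G1 G2 G : bgraph) (i1 : embedding G1 G)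
    (i2 : embedding G2 G) :
  (forall v1 v2, emb_v i1 v1 <> emb_v i2 v2) ->
  (forall e, (exists e1, e = emb_e i1 e1) \/ (exists e2, e = emb_e i2 e2)) ->
  forall e', (forall e, e' <> emb_e i1 e) -> forall v, org e' <> emb_v i1 v.
Proof.
move=> dv ce e' ei v; case: (ce e') => [[e1 /ei//]|[e2 ->]].
by rewrite emb_org => /esym/dv.
Qed.

(** In the situation of a boundary spike [e], the vertex [org e] is new and [e] is
    the only edge that starts there. *)
Lemma spike_org (G G' : bgraph) (i : embedding G G') (e : edge G')
    (y : vertex G) :
  (forall v', v' = org e <-> ~ exists v, v' = emb_v i v) ->
  (forall e', (e' = e \/ e' = rev e) <-> ~ exists e0, e' = emb_e i e0) ->
  dst e = emb_v i y ->
  (forall v, org e <> emb_v i v) /\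
  (forall e', org e' = org e -> e' = e).
Proof.
move=> vP eP dy.
have oe v : org e <> emb_v i v by move=> ev; case: ((vP (org e)).1 erefl); exists v.
split=> // e' oe'; have [[e0 e0']|ne] := emb_eP i e'.
  by case: (oe (org e0)); rewrite -oe' e0' emb_org.
case: ((eP e').2) => [[e0 /ne]|//|re] //.
by case: (oe y); rewrite -oe' re org_rev.
Qed.

(** At a vertex with a single edge the equation [laplacian_fun w u = 0] says that
    [u] is constant along that edge, since weights are units. *)
Lemma spike_potential (R : comPzRingType) (G : bgraph) (w : network G R)
    (e : edge G) (u : vertex G -> R) :
  (forall e', org e' = org e -> e' = e) ->
  laplacian_fun w u (org e) = 0 -> u (dst e) = u (org e).
Proof.
move=> oe; rewrite /laplacian_fun (big_pred1 e); last first.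
  by move=> e' /=; apply/eqP/eqP => [/oe|->].
have [v vw] := weight_unit w e.
move/(congr1 ( *%R v)); rewrite mulrA vw mul1r mulr0 => /eqP.
by rewrite subr_eq0 => /eqP.
Qed.

Lemma completely_reducible_non_degenerate (G : bgraph) :
  completely_reducible G ->
  forall (R : comPzRingType) (w : network G R), non_degenerate w.
Proof.
move: G; apply: completely_reducible_induction.
- by move=> G G0 R w u _ _ x; have := fintype0 x G0.
- by move=> R w u u0 _ x; apply: u0; rewrite boundaryE finset.in_set0.
- move=> G G' IH [i [e [y [vP eP [dy yb] iP eb]]]] R w u u0 Lu.
  have [oi oe] := spike_org vP eP dy.
  have uy : u (dst e) = 0 by rewrite (spike_potential oe (Lu _)) u0.
  have ui v : u (emb_v i v) = 0.
    apply: (IH R (pull_network i w) (fun v => u (emb_v i v))) => {v} v.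
      move=> vb; have [->|vy] := eqVneq v y; first by rewrite -dy.
      by apply: u0; rewrite boundaryE iP (negbTE vy) orbF -boundaryE.
    rewrite -laplacian_fun_pull_at ?Lu // => e' ei oe'; rewrite -oe'.
    have [->|->] : e' = e \/ e' = rev e by apply/eP => -[e0 /ei].
      by rewrite uy u0.
    by rewrite org_rev dst_rev uy u0.
  move=> x; have [[v ->]//|nv] := emb_vP i x.
  by rewrite u0 //; suff -> : x = org e by []; apply/vP => -[v /nv].
- move=> G G' IH [i [e [vP eP iP [ob db]]]] R w u u0 Lu x.
  have [v ->] := vP x.
  apply: (IH R (pull_network i w) (fun v => u (emb_v i v))) => {x v} v.
    by move=> vb; apply: u0; rewrite boundaryE iP -boundaryE.
  rewrite -laplacian_fun_pull_at ?Lu // => e' ei oe'; rewrite -oe'.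
  have [->|->] : e' = e \/ e' = rev e by apply/eP => -[e0 /ei].
    by rewrite !u0.
  by rewrite org_rev dst_rev !u0.
- suff half (G1 G2 G : bgraph) (i1 : embedding G1 G) (i2 : embedding G2 G) :
      (forall (R : comPzRingType) (w : network G1 R), non_degenerate w) ->
      preserves_interior i1 -> (forall v1 v2, emb_v i1 v1 <> emb_v i2 v2) ->
      (forall e, (exists e1, e = emb_e i1 e1) \/ (exists e2, e = emb_e i2 e2)) ->
      forall (R : comPzRingType) (w : network G R) u,
      (forall x, x \in boundary G -> u x = 0) ->
      (forall x, laplacian_fun w u x = 0) -> forall v, u (emb_v i1 v) = 0.
    move=> G1 G2 G IH1 IH2 [i1 [i2 [[p1 p2] cv dv ce de]]] R w u u0 Lu x.
    case: (cv x) => [[v ->]|[v ->]]; first exact: (half _ _ _ i1 i2).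
    apply: (half _ _ _ i2 i1) => // [v1 v2 /esym /dv//|e].
    by case: (ce e); [right|left].
  move=> IH p1 dv ce R w u u0 Lu v.
  apply: (IH R (pull_network i1 w) (fun v => u (emb_v i1 v))) => {v} v.
    by move=> vb; apply: u0; rewrite boundaryE p1 -boundaryE.
  rewrite -laplacian_fun_pull_at ?Lu // => e' ei oe'.
  by case: (disjoint_union_org dv ce ei oe').
- suff half (G1 G2 G : bgraph) (x1 : vertex G1) (x2 : vertex G2)
      (i1 : embedding G1 G) (i2 : embedding G2 G) :
      (forall (R : comPzRingType) (w : network G1 R), non_degenerate w) ->
      preserves_interior i1 ->
      (forall v1 v2, emb_v i1 v1 = emb_v i2 v2 -> v1 = x1) ->
      (forall e, (exists e1, e = emb_e i1 e1) \/ (exists e2, e = emb_e i2 e2)) ->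
      forall (R : comPzRingType) (w : network G R) u,
      (forall x, x \in boundary G -> u x = 0) ->
      (forall x, laplacian_fun w u x = 0) -> forall v, u (emb_v i1 v) = 0.
    move=> G1 G2 G IH1 IH2 [x1 [x2 [i1 [i2 [_ [p1 p2] [cv dv] ce de]]]]] R w u u0 Lu x.
    case: (cv x) => [[v ->]|[v ->]].
      by apply: (half _ _ _ x1 x2 i1 i2) => // v1 v2 /dv[].
    apply: (half _ _ _ x2 x1 i2 i1) => // [v1 v2 /esym /dv[]//|e].
    by case: (ce e); [right|left].
  move=> IH p1 dv ce R w u u0 Lu v.
  pose u1 v := u (emb_v i1 v).
  have L1 y : y != x1 -> laplacian_fun (pull_network i1 w) u1 y = 0.
    move=> yx; rewrite -laplacian_fun_pull_at ?Lu // => e' ei oe'.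
    case: (ce e') => [[e1 /ei//]|[e2 e2']].
    by case/eqP: yx; apply: (dv _ (org e2)); rewrite -emb_org -e2'.
  apply: (IH R (pull_network i1 w) u1) => {v} v.
    by move=> vb; apply: u0; rewrite boundaryE p1 -boundaryE.
  have [->|] := eqVneq v x1; last exact: L1.
  (* The equation of [G] at the common vertex only concerns the sum of the two
     halves, but the values of the Laplacian of [u1] sum to zero. *)
  have := sum_laplacian_fun (pull_network i1 w) u1.
  by rewrite (bigD1 x1) //= big1 ?addr0 // => y /L1.
Qed.

(** * Dual bases *)

Lemma sum_option (I : finType) (M : nmodType) (F : option I -> M) :
  \sum_o F o = F None + \sum_i F (Some i).
Proof.
rewrite (bigD1 None) //=; congr (_ + _).
rewrite (sum_inj (h := Some)) //; first exact: Some_inj.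
by move=> [i|//] _ /(_ i).
Qed.

Section DualBases.
Variables (G : bgraph) (R : comPzRingType) (w : network G R).
Implicit Types (A : vertex G -> Prop) (k c s psi : vertex G -> R).

(** The module R V / (L(R V^o) + R A), where [A] is a set of vertices, is free on
    the classes of the chains [b i], the coordinates being the pairings with the
    functions [phi i].  These vanish on [A] and are harmonic on the interior,
    which says that the pairings are well defined on the quotient. *)
Definition dual_bases A : Prop :=
  exists (I : finType) (b phi : I -> vertex G -> R),
    [/\ forall i v, A v -> phi i v = 0,
        forall i x, x \in interior G -> laplacian_fun w (phi i) x = 0,
        forall i j, \sum_x phi i x * b j x = (i == j)%:R
      & forall k, exists c s,
          [/\ forall x, x \notin interior G -> c x = 0,
              forall x, ~ A x -> s x = 0
            & forall x, k x = \sum_i (\sum_y phi i y * k y) * b i x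
                              + laplacian_fun w c x + s x]].

(** The same for ker eps / L(R V^o), the [b i] having augmentation zero. *)
Definition kernel_dual_bases : Prop :=
  exists (I : finType) (b phi : I -> vertex G -> R),
    [/\ forall i, \sum_x b i x = 0,
        forall i x, x \in interior G -> laplacian_fun w (phi i) x = 0,
        forall i j, \sum_x phi i x * b j x = (i == j)%:R
      & forall k, \sum_x k x = 0 -> exists2 c,
          forall x, x \notin interior G -> c x = 0
          & forall x, k x = \sum_i (\sum_y phi i y * k y) * b i x
                            + laplacian_fun w c x].

Lemma harmonic_laplacian psi c :
  (forall x, x \in interior G -> laplacian_fun w psi x = 0) ->
  (forall x, x \notin interior G -> c x = 0) ->
  \sum_x psi x * laplacian_fun w c x = 0.
Proof.
move=> hpsi c0; rewrite laplacian_selfadj big1 // => x _.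
by have [/hpsi->|/c0->] := boolP (x \in interior G); rewrite ?mul0r ?mulr0.
Qed.

Lemma sum_delta psi a : \sum_x psi x * (x == a)%:R = psi a.
Proof.
by rewrite (bigD1 a) //= eqxx mulr1 big1 ?addr0 // => x /negbTE->; rewrite mulr0.
Qed.

Lemma sum_deltaZ psi r a : \sum_x psi x * (r * (x == a)%:R) = r * psi a.
Proof.
under eq_bigr do rewrite mulrCA.
by rewrite -mulr_sumr sum_delta.
Qed.

Lemma sum_deltaC (r : R) (a : vertex G) : \sum_x r * (x == a)%:R = r.
Proof. exact: (sum_delta (fun=> r)). Qed.

(** As R V is the direct sum of ker eps and R a, the quotients ker eps / L(R V^o)
    and R V / (L(R V^o) + R a) are isomorphic for every vertex [a]: this lemma and
    the next one.  The first one changes [b i] by a multiple of [a], the second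
    one changes [phi i] by a constant. *)
Lemma dual_bases_kernel a : dual_bases (eq a) -> kernel_dual_bases.
Proof.
case=> I [b [phi [phiA hphi dual spn]]].
pose eps f := \sum_(x : vertex G) f x : R.
pose b' i x := b i x - eps (b i) * (x == a)%:R.
have epsb i : eps (b' i) = 0.
  by rewrite /eps sumrB sum_deltaC subrr.
exists I, b', phi; split=> //.
  move=> i j; rewrite -dual /b'.
  under eq_bigr do rewrite mulrBr.
  by rewrite sumrB sum_deltaZ (phiA i a erefl) mulr0 subr0.
move=> k k0; have [c [s [c0 s0 kE]]] := spn k.
exists c => // x.
pose q i := \sum_y phi i y * k y.
have kE' y : k y = \sum_i q i * b' i y + laplacian_fun w c y
    + (\sum_i q i * eps (b i) + s a) * (y == a)%:R.
  rewrite kE (_ : s y = s a * (y == a)%:R); last first.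
    by have [->|/eqP ya] := eqVneq y a; rewrite ?mulr1 // mulr0 s0 // => /esym.
  rewrite mulrDl addrA; congr (_ + _); rewrite addrAC; congr (_ + _).
  rewrite mulr_suml -big_split /=; apply: eq_bigr => j _.
  by rewrite -mulrA -mulrDr subrK.
suff r0 : \sum_i q i * eps (b i) + s a = 0 by rewrite kE' r0 mul0r addr0.
have : \sum_x k x = 0 by [].
under eq_bigr do rewrite kE'.
rewrite !big_split /= sum_laplacian_fun addr0 exchange_big big1 /=; last first.
  by move=> i _; rewrite -mulr_sumr [X in _ * X]epsb mulr0.
by rewrite add0r sum_deltaC.
Qed.

Lemma kernel_dual_bases_at a : kernel_dual_bases -> dual_bases (eq a).
Proof.
case=> I [b [phi [epsb hphi dual spn]]].
have sub i k : \sum_x (phi i x - phi i a) * k x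
    = \sum_x phi i x * k x - phi i a * \sum_x k x.
  by rewrite mulr_sumr -sumrB; apply: eq_bigr => x _; rewrite mulrBl.
exists I, b, (fun i x => phi i x - phi i a); split.
- by move=> i _ <-; rewrite subrr.
- move=> i x xi; rewrite (laplacian_funD w (phi i) (fun=> - phi i a)).
  by rewrite hphi // laplacian_fun_cst addr0.
- by move=> i j; rewrite sub epsb mulr0 subr0.
- move=> k; pose e := \sum_x k x.
  have [|c c0 kE] := spn (fun x => k x - e * (x == a)%:R).
    by rewrite sumrB sum_deltaC subrr.
  exists c, (fun x => e * (x == a)%:R); split=> //.
    by move=> x /eqP; rewrite eq_sym => /negbTE ->; rewrite mulr0.
  move=> x; apply/eqP; rewrite -subr_eq kE; apply/eqP; congr (_ + _).
  apply: eq_bigr => i _; congr (_ * _); rewrite sub.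
  under eq_bigr do rewrite mulrBr.
  by rewrite sumrB sum_deltaZ [phi i a * _]mulrC.
Qed.

(** A function harmonic on the interior, zero on [A] and equal to 1 at [a] splits
    off the class of [a]. *)
Lemma dual_bases_remove A A' a psi :
  (forall v, A' v -> A v \/ v = a) ->
  (forall v, A v -> psi v = 0) -> psi a = 1 -> A' a ->
  (forall v, A v -> A' v) ->
  (forall x, x \in interior G -> laplacian_fun w psi x = 0) ->
  dual_bases A' -> dual_bases A.
Proof.
move=> AA psiA psia aA AA' hpsi [I [b [phi [phiA hphi dual spn]]]].
pose p i := \sum_x psi x * b i x.
pose b' (o : option I) x :=
  if o is Some i then b i x - p i * (x == a)%:R else (x == a)%:R.
pose phi' (o : option I) := if o is Some i then phi i else psi.
exists (option I), b', phi'; split.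
- by move=> [i|] v Av /=; [apply/phiA/AA'|apply: psiA].
- by move=> [i|] x xi /=; [apply: hphi|apply: hpsi].
- move=> [i|] [j|] /=.
  + under eq_bigr do rewrite mulrBr.
    by rewrite sumrB sum_deltaZ dual phiA // mulr0 subr0.
  + by rewrite sum_delta phiA.
  + under eq_bigr do rewrite mulrBr.
    by rewrite sumrB sum_deltaZ psia mulr1 subrr.
  + by rewrite sum_delta.
- move=> k; have [c [s [c0 s0 kE]]] := spn k.
  pose s' x := if x == a then 0 else s x.
  pose q i := \sum_y phi i y * k y.
  have s'0 x : ~ A x -> s' x = 0.
    rewrite /s'; case: eqP => // xa Ax; apply: s0 => /AA[//|]; exact: xa.
  have sE x : s x = s' x + s a * (x == a)%:R.
    by rewrite /s'; case: eqP => [->|_]; rewrite ?mulr1 ?add0r // mulr0 addr0.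
  exists c, s'; split=> // x.
  suff psik : \sum_y psi y * k y = \sum_i q i * p i + s a.
    rewrite sum_option /= psik {1}kE sE.
    under [in RHS]eq_bigr do rewrite mulrBr mulrA.
    rewrite sumrB -mulr_suml -/q mulrDl.
    ring.
  under eq_bigr do rewrite kE sE !mulrDr.
  rewrite !big_split /= harmonic_laplacian // addr0 sum_deltaZ psia mulr1.
  rewrite addrA; congr (_ + _); rewrite [X in _ + X]big1 ?addr0.
    under eq_bigr do rewrite mulr_sumr.
    rewrite exchange_big; apply: eq_bigr => i _ /=.
    by rewrite /p mulr_sumr; apply: eq_bigr => y _; rewrite mulrCA.
  move=> y _; have [/psiA->|/s'0->] := pselect (A y); first by rewrite mul0r.
  by rewrite mulr0.
Qed.

End DualBases.

Lemma eq_push (G1 G : bgraph) (i : embedding G1 G) (R : comPzRingType)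
  (f g : vertex G1 -> R) : f =1 g -> push i f =1 push i g.
Proof. by move=> fg v; apply: eq_bigr => v1 _; apply: fg. Qed.

Lemma sum_pushl (G1 G : bgraph) (i : embedding G1 G) (R : comPzRingType)
  (f : vertex G1 -> R) (k : vertex G -> R) :
  \sum_v push i f v * k v = \sum_v1 f v1 * k (emb_v i v1).
Proof.
under eq_bigr do rewrite mulrC.
by rewrite sum_push; apply: eq_bigr => v _; rewrite mulrC.
Qed.

Lemma eps_push (G1 G : bgraph) (i : embedding G1 G) (R : comPzRingType)
  (f : vertex G1 -> R) : \sum_v push i f v = \sum_v f v.
Proof.
transitivity (\sum_v push i f v * 1); first by apply: eq_bigr => v _; rewrite mulr1.
by rewrite sum_pushl; apply: eq_bigr => v _; rewrite mulr1.
Qed.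

Lemma push_sum (G1 G : bgraph) (i : embedding G1 G) (R : comPzRingType)
  (I : finType) (a : I -> R) (f : I -> vertex G1 -> R) v :
  push i (fun x => \sum_j a j * f j x) v = \sum_j a j * push i (f j) v.
Proof.
by rewrite /push exchange_big; apply: eq_bigr => j _; rewrite /= mulr_sumr.
Qed.

(** When two networks meet only in the sets [A1] and [A2], the relative quotients
    add up; the functions are extended by zero, which preserves harmonicity
    because they vanish where the networks meet. *)
Lemma dual_bases_glue (R : comPzRingType) (G1 G2 G : bgraph) (w : network G R)
    (i1 : embedding G1 G) (i2 : embedding G2 G)
    (A1 : vertex G1 -> Prop) (A2 : vertex G2 -> Prop) (A : vertex G -> Prop) :
  open_embedding i1 -> open_embedding i2 ->
  (forall v, (exists v1, v = emb_v i1 v1) \/ (exists v2, v = emb_v i2 v2)) ->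
  (forall v, v \in interior G ->
    (exists2 v1, v1 \in interior G1 & v = emb_v i1 v1) \/
    (exists2 v2, v2 \in interior G2 & v = emb_v i2 v2)) ->
  (forall v1 v2, emb_v i1 v1 = emb_v i2 v2 -> A1 v1 /\ A2 v2) ->
  (forall v1, A1 v1 <-> A (emb_v i1 v1)) ->
  (forall v2, A2 v2 <-> A (emb_v i2 v2)) ->
  dual_bases (pull_network i1 w) A1 -> dual_bases (pull_network i2 w) A2 ->
  dual_bases w A.
Proof.
move=> o1 o2 cv cint meet A1E A2E [I1 [b1 [phi1 [phi1A hphi1 dual1 spn1]]]].
case=> I2 [b2 [phi2 [phi2A hphi2 dual2 spn2]]].
pose b (o : I1 + I2) := match o with
  inl i => push i1 (b1 i) | inr i => push i2 (b2 i) end.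
pose phi (o : I1 + I2) := match o with
  inl i => push i1 (phi1 i) | inr i => push i2 (phi2 i) end.
have cross12 i v2 : push i1 (phi1 i) (emb_v i2 v2) = 0.
  have [[v1 e]|] := emb_vP i1 (emb_v i2 v2); last exact: push_out.
  by rewrite e push_emb phi1A //; case: (meet v1 v2).
have cross21 i v1 : push i2 (phi2 i) (emb_v i1 v1) = 0.
  have [[v2 e]|] := emb_vP i2 (emb_v i1 v1); last exact: push_out.
  by rewrite e push_emb phi2A //; case: (meet v1 v2).
exists (I1 + I2)%type, b, phi; split.
- move=> [i|i] v Av /=; case: (cv v) => [[u e]|[u e]]; rewrite e in Av *.
  + by rewrite push_emb phi1A //; apply/A1E.
  + exact: cross12.
  + exact: cross21.
  + by rewrite push_emb phi2A //; apply/A2E.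
- move=> [i|i] v vi /=; case: (cint v vi) => [[u ui ->]|[u ui ->]].
  + rewrite (laplacian_fun_pull _ o1) // -[RHS](hphi1 i u ui).
    by apply: eq_laplacian_fun => x; rewrite push_emb.
  + rewrite (laplacian_fun_pull _ o2) // laplacian_fun_eq0 // => e _.
    by rewrite !cross12.
  + rewrite (laplacian_fun_pull _ o1) // laplacian_fun_eq0 // => e _.
    by rewrite !cross21.
  + rewrite (laplacian_fun_pull _ o2) // -[RHS](hphi2 i u ui).
    by apply: eq_laplacian_fun => x; rewrite push_emb.
- move=> [i|i] [j|j] /=; rewrite sum_push.
  + by under eq_bigr do rewrite push_emb; apply: dual1.
  + by under eq_bigr do rewrite cross12 mul0r; rewrite big1.
  + by under eq_bigr do rewrite cross21 mul0r; rewrite big1.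
  + by under eq_bigr do rewrite push_emb; apply: dual2.
- move=> k.
  pose k1 v1 := k (emb_v i1 v1).
  (* [k] is the sum of two extensions by zero; its values at common vertices go
     to the first one. *)
  pose k2 v2 := if `[< exists v1, emb_v i2 v2 = emb_v i1 v1 >] then 0 else k (emb_v i2 v2).
  have kE v : k v = push i1 k1 v + push i2 k2 v.
    have [[v1 ->]|nv1] := emb_vP i1 v.
      rewrite push_emb; have [[v2 e]|nv2] := emb_vP i2 (emb_v i1 v1).
        rewrite e push_emb /k2 asboolT; last by exists v1.
        by rewrite addr0 -e.
      by rewrite push_out ?addr0.
    rewrite [X in X + _]push_out // add0r.
    case: (cv v) => [[v1 /nv1]//|[v2 e]].
    rewrite e push_emb /k2 asboolF // => -[v1]; rewrite -e; exact: nv1.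
  have [c1 [s1 [c10 s10 k1E]]] := spn1 k1.
  have [c2 [s2 [c20 s20 k2E]]] := spn2 k2.
  have qE1 i : \sum_y push i1 (phi1 i) y * k y = \sum_y phi1 i y * k1 y.
    exact: sum_pushl.
  have qE2 i : \sum_y push i2 (phi2 i) y * k y = \sum_y phi2 i y * k2 y.
    rewrite sum_pushl; apply: eq_bigr => v2 _.
    rewrite /k2; case: asboolP => // -[v1 e].
    by rewrite phi2A ?mul0r //; case: (meet v1 v2).
  exists (fun v => push i1 c1 v + push i2 c2 v),
         (fun v => push i1 s1 v + push i2 s2 v); split.
  + move=> v vi.
    have p1 : push i1 c1 v = 0.
      have [[u e]|] := emb_vP i1 v; last exact: push_out.
      rewrite e push_emb c10 //; apply/negP => /o1.1; rewrite -e; exact/negP.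
    have p2 : push i2 c2 v = 0.
      have [[u e]|] := emb_vP i2 v; last exact: push_out.
      rewrite e push_emb c20 //; apply/negP => /o2.1; rewrite -e; exact/negP.
    by rewrite p1 p2 addr0.
  + move=> v nA.
    have p1 : push i1 s1 v = 0.
      have [[u e]|] := emb_vP i1 v; last exact: push_out.
      by rewrite e push_emb s10 // => /A1E; rewrite -e.
    have p2 : push i2 s2 v = 0.
      have [[u e]|] := emb_vP i2 v; last exact: push_out.
      by rewrite e push_emb s20 // => /A2E; rewrite -e.
    by rewrite p1 p2 addr0.
  + move=> v; rewrite {1}kE (eq_push i1 k1E) (eq_push i2 k2E) !pushD !push_sum.
    rewrite laplacian_funD !laplacian_fun_push //.
    rewrite big_sumType /=.
    under [in RHS]eq_bigr do rewrite qE1.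
    under [X in _ = _ + X + _ + _]eq_bigr do rewrite qE2.
    ring.
Qed.

Lemma preserves_interior_open (G1 G : bgraph) (i : embedding G1 G) :
  preserves_interior i ->
  (forall e', (forall e, e' <> emb_e i e) ->
    forall v, v \in interior G1 -> org e' <> emb_v i v) -> open_embedding i.
Proof. by move=> p h; split=> // v; rewrite p. Qed.

Lemma kernel_dual_bases_empty (R : comPzRingType) (G : bgraph) (w : network G R) :
  #|vertex G| = 0%N -> kernel_dual_bases w.
Proof.
move=> G0; exists void, (fun e : void => match e with end),
  (fun e : void => match e with end).
split=> [[]|[]|[]|k _]; exists (fun=> 0) => // x; have := fintype0 x G0; done.
Qed.

Lemma kernel_dual_bases_point (R : comPzRingType) (w : network point R) :
  kernel_dual_bases w.
Proof.
exists void, (fun e : void => match e with end),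
  (fun e : void => match e with end).
split=> [[]|[]|[]|k].
rewrite (big_pred1 tt) => [k0|[]//].
exists (fun=> 0) => // -[]; rewrite k0 big1 => [|[]//].
by rewrite laplacian_fun_cst addr0.
Qed.

Lemma kernel_dual_bases_disjoint_union (G1 G2 G : bgraph) :
  (forall (R : comPzRingType) (w : network G1 R), kernel_dual_bases w) ->
  (forall (R : comPzRingType) (w : network G2 R), kernel_dual_bases w) ->
  is_disjoint_union G1 G2 G ->
  forall (R : comPzRingType) (w : network G R), kernel_dual_bases w.
Proof.
move=> H1 H2 [i1 [i2 [[p1 p2] cv dv ce de]]] R w.
have dv' v1 v2 : emb_v i2 v1 <> emb_v i1 v2 by move=> /esym/dv.
have o1 : open_embedding i1.
  by apply: preserves_interior_open => // e' ei v _; apply: (disjoint_union_org dv ce ei).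
have o2 : open_embedding i2.
  apply: preserves_interior_open => // e' ei v _.
  by apply: (disjoint_union_org dv' _ ei) => e; case: (ce e); [right|left].
have cint v : v \in interior G ->
    (exists2 v1, v1 \in interior G1 & v = emb_v i1 v1) \/
    (exists2 v2, v2 \in interior G2 & v = emb_v i2 v2).
  case: (cv v) => [[u ->]|[u ->]] ui; [left|right]; exists u => //.
    by rewrite -p1.
  by rewrite -p2.
have dual0 (G' : bgraph) (w' : network G' R) : #|vertex G'| = 0%N ->
    dual_bases w' (fun=> False).
  move=> G0; exists void, (fun e : void => match e with end),
  (fun e : void => match e with end).
  split=> [[]|[]|[]|k]; exists (fun=> 0), (fun=> 0); split=> // x.
  by have := fintype0 x G0.
have [G10|/card_gt0P[a1 _]] := posnP #|vertex G1|.
  have [G20|/card_gt0P[a2 _]] := posnP #|vertex G2|.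
    apply: kernel_dual_bases_empty; apply: eq_card0 => v.
    by case: (cv v) => -[u _]; [have := fintype0 u G10|have := fintype0 u G20].
  apply: (@dual_bases_kernel _ _ _ (emb_v i2 a2)).
  apply: (dual_bases_glue o1 o2 cv cint _ _ _ (dual0 _ _ G10)
    (kernel_dual_bases_at a2 (H2 _ _))).
  - by move=> v1 v2 /dv.
  - by move=> v1; split=> // /dv'.
  - by move=> v2; split=> [->|/emb_v_inj].
have [G20|/card_gt0P[a2 _]] := posnP #|vertex G2|.
  apply: (@dual_bases_kernel _ _ _ (emb_v i1 a1)).
  apply: (dual_bases_glue o1 o2 cv cint _ _ _
    (kernel_dual_bases_at a1 (H1 _ _)) (dual0 _ _ G20)).
  - by move=> v1 v2 /dv.
  - by move=> v1; split=> [->|/emb_v_inj].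
  - by move=> v1; split=> // /dv.
apply: (@dual_bases_kernel _ _ _ (emb_v i1 a1)).
(* Gluing gives the quotient relative to one vertex in each part; the indicator
   function of the second part then removes one of the two. *)
apply: (@dual_bases_remove _ _ _ _ (fun v => emb_v i1 a1 = v \/ v = emb_v i2 a2)
  (emb_v i2 a2) (push i2 (fun=> 1))).
- by move=> v [->|->]; [left|right].
- by move=> v <-; apply: push_out => v2; apply: dv.
- by rewrite push_emb.
- by right.
- by move=> v; left.
- move=> v /cint[[u ui ->]|[u ui ->]].
    rewrite (laplacian_fun_pull _ o1) // laplacian_fun_eq0 // => e _.
    by rewrite !push_out // => v2; apply: dv.
  rewrite (laplacian_fun_pull _ o2) // laplacian_fun_eq0 // => e _.
  by rewrite !push_emb.
apply: (dual_bases_glue o1 o2 cv cint _ _ _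
  (kernel_dual_bases_at a1 (H1 _ _)) (kernel_dual_bases_at a2 (H2 _ _))).
- by move=> v1 v2 /dv.
- by move=> v1; split=> [->|[/emb_v_inj|/dv]//]; left.
- by move=> v1; split=> [->|[/dv|/emb_v_inj]//]; right.
Qed.

Lemma kernel_dual_bases_wedge (G1 G2 G : bgraph) :
  (forall (R : comPzRingType) (w : network G1 R), kernel_dual_bases w) ->
  (forall (R : comPzRingType) (w : network G2 R), kernel_dual_bases w) ->
  is_boundary_wedge_sum G1 G2 G ->
  forall (R : comPzRingType) (w : network G R), kernel_dual_bases w.
Proof.
move=> H1 H2 [a1 [a2 [i1 [i2 [[xb1 xb2] [p1 p2] [cv dv] ce de]]]]] R w.
have ea : emb_v i1 a1 = emb_v i2 a2 by apply/dv.
have o1 : open_embedding i1.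
  apply: preserves_interior_open => // e' ei v vi ev.
  case: (ce e') => [[e1 /ei//]|[e2 e2']].
  move: ev; rewrite e2' emb_org => /esym /dv[va _].
  by move: xb1; rewrite boundaryE -va vi.
have o2 : open_embedding i2.
  apply: preserves_interior_open => // e' ei v vi ev.
  case: (ce e') => [[e1 e1']|[e2 /ei//]].
  move: ev; rewrite e1' emb_org => /dv[_ va].
  by move: xb2; rewrite boundaryE -va vi.
apply: (@dual_bases_kernel _ _ _ (emb_v i1 a1)).
apply: (dual_bases_glue o1 o2 cv _ _ _ _
  (kernel_dual_bases_at a1 (H1 _ _)) (kernel_dual_bases_at a2 (H2 _ _))).
- move=> v; case: (cv v) => [[u ->]|[u ->]] ui; [left|right]; exists u => //.
    by rewrite -p1.
  by rewrite -p2.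
- by move=> v1 v2 /dv[-> ->].
- by move=> v1; split=> [->|/emb_v_inj].
- by move=> v1; rewrite ea; split=> [->|/emb_v_inj].
Qed.

Lemma kernel_dual_bases_boundary_edge (G G' : bgraph) :
  (forall (R : comPzRingType) (w : network G R), kernel_dual_bases w) ->
  adjoins_boundary_edge G G' ->
  forall (R : comPzRingType) (w : network G' R), kernel_dual_bases w.
Proof.
move=> H [i [e [vP eP iP [ob db]]]] R w.
have oi : open_embedding i.
  apply: preserves_interior_open => // e' ei v vi.
  have [->|->] : e' = e \/ e' = rev e by apply/eP => -[e0 /ei].
    by move=> ev; move: ob; rewrite boundaryE ev iP vi.
  by rewrite org_rev => ev; move: db; rewrite boundaryE ev iP vi.
have [I [b [phi [epsb hphi dual spn]]]] := H R (pull_network i w).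
have pushK (k : vertex G' -> R) : k =1 push i (fun v => k (emb_v i v)).
  by move=> v; have [u ->] := vP v; rewrite push_emb.
exists I, (fun j => push i (b j)), (fun j => push i (phi j)); split.
- by move=> j; rewrite eps_push.
- move=> j x; have [v ->] := vP x; rewrite iP => vi.
  rewrite (laplacian_fun_pull _ oi) // -[RHS](hphi j v vi).
  by apply: eq_laplacian_fun => y; rewrite push_emb.
- by move=> j1 j2; rewrite sum_push; under eq_bigr do rewrite push_emb; apply: dual.
- move=> k k0; have [|c c0 kE] := spn (fun v => k (emb_v i v)).
    by rewrite -(eps_push i) -[RHS]k0; apply: eq_bigr => v _; rewrite -pushK.
  exists (push i c) => [x|x]; first by have [v ->] := vP x; rewrite iP push_emb; apply: c0.
  rewrite [LHS]pushK (eq_push i kE) pushD push_sum laplacian_fun_push //.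
  by under [in RHS]eq_bigr do rewrite sum_pushl.
Qed.

Lemma kernel_dual_bases_spike (G G' : bgraph) :
  (forall (R : comPzRingType) (w : network G R), kernel_dual_bases w) ->
  adjoins_spike G G' ->
  forall (R : comPzRingType) (w : network G' R), kernel_dual_bases w.
Proof.
move=> H [i [e [y [vP eP [dy yb] iP eb]]]] R w.
have [oi oe] := spike_org vP eP dy.
have op : open_embedding i.
  split=> [v vi|e' ei v vi]; first by rewrite iP vi.
  have [->|->] : e' = e \/ e' = rev e by apply/eP => -[e0 /ei].
    exact: oi.
  rewrite org_rev dy => /emb_v_inj yv.
  by move: yb; rewrite boundaryE yv vi.
have [I [b [phi [epsb hphi dual spn]]]] := H R (pull_network i w).
have [v vw] := weight_unit w e.
(* The value at the tip of the spike that makes [phi j] harmonic at [y]. *)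
pose t j := phi j y + v * laplacian_fun (pull_network i w) (phi j) y.
pose phi' j x := push i (phi j) x + t j * (x == org e)%:R.
have emb_neq u : (emb_v i u == org e) = false by apply/eqP => /esym/oi.
have phi'_emb j u : phi' j (emb_v i u) = phi j u.
  by rewrite /phi' push_emb emb_neq mulr0 addr0.
have phi'_org j : phi' j (org e) = t j.
  by rewrite /phi' push_out // add0r eqxx mulr1.
have hphi' j x : x \in interior G' -> laplacian_fun w (phi' j) x = 0.
  have [[u ->]|nv] := emb_vP i x; last first.
    have -> : x = org e by apply/vP => -[u /nv].
    by rewrite boundaryE in eb; rewrite (negbTE eb).
  rewrite iP => /orP[ui|/eqP->].
    rewrite (laplacian_fun_pull _ op) // -[RHS](hphi j u ui).
    by apply: eq_laplacian_fun => z; rewrite phi'_emb.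
  rewrite /laplacian_fun (bigD1 (rev e)) /=; last by rewrite org_rev dy.
  rewrite weight_rev dst_rev phi'_emb phi'_org.
  rewrite (sum_inj (h := emb_e i)); last first.
  - move=> e' /andP[/eqP oe' /eqP ne'] ei.
    have [ee|//] : e' = e \/ e' = rev e by apply/eP => -[e0 /ei].
    by move: oe'; rewrite ee => /oi.
  - exact: emb_e_inj.
  rewrite (eq_bigl (fun e0 => org e0 == y)); last first.
    move=> e0; rewrite emb_org (inj_eq (@emb_v_inj _ _ i)); case: eqP => //= _.
    apply/eqP => ee; case: ((eP (emb_e i e0)).1 _); last by exists e0.
    by right.
  rewrite (eq_bigr (fun e0 => pull_network i w e0 * (phi j y - phi j (dst e0)))); last first.
    by move=> e0 _; rewrite emb_dst !phi'_emb.
  rewrite -/(laplacian_fun (pull_network i w) (phi j) y) /t.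
  set L := laplacian_fun _ _ _.
  rewrite (_ : w e * (phi j y - (phi j y + v * L)) = - (v * w e) * L); last by ring.
  by rewrite vw; ring.
exists I, (fun j => push i (b j)), phi'; split=> //.
- by move=> j; rewrite eps_push.
- by move=> j1 j2; rewrite sum_push; under eq_bigr do rewrite phi'_emb; apply: dual.
- move=> k k0; pose d x := (x == emb_v i y)%:R : R.
  (* Adding a multiple of the Laplacian of the new interior vertex to [k] makes
     its coefficient at the tip of the spike zero. *)
  pose r := k (org e) * v.
  pose k1 x := k x + r * laplacian_fun w d x.
  have d0 x : x \notin interior G' -> d x = 0.
    by rewrite /d; case: eqP => // ->; rewrite iP eqxx orbT.
  have k1e : k1 (org e) = 0.
    rewrite /k1 /laplacian_fun (big_pred1 e); last first.
      by move=> e' /=; apply/eqP/eqP => [/oe|->].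
    rewrite /d dy eqxx eq_sym emb_neq /r.
    rewrite (_ : k (org e) + _ = k (org e) * (1 - v * w e)); first by rewrite vw subrr mulr0.
    by rewrite [false%:R]mulr0n [true%:R]mulr1n; ring.
  have k1E : k1 =1 push i (fun u => k1 (emb_v i u)).
    move=> x; have [[u ->]|nv] := emb_vP i x; first by rewrite push_emb.
    by rewrite push_out //; have -> : x = org e by apply/vP => -[u /nv].
  have eps1 : \sum_x k1 x = 0.
    by rewrite big_split /= k0 -mulr_sumr sum_laplacian_fun mulr0 addr0.
  have [|c c0 kE] := spn (fun u => k1 (emb_v i u)).
    by rewrite -(eps_push i) -[RHS]eps1; apply: eq_bigr => x _; rewrite -k1E.
  have qE j : \sum_x phi' j x * k x = \sum_u phi j u * k1 (emb_v i u).
    transitivity (\sum_x phi' j x * k1 x).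
      rewrite /k1; under [in RHS]eq_bigr do rewrite mulrDr mulrCA.
      by rewrite big_split /= -mulr_sumr harmonic_laplacian ?mulr0 ?addr0 //; apply: hphi'.
    under eq_bigr do rewrite k1E.
    by rewrite sum_push; apply: eq_bigr => u _; rewrite phi'_emb.
  exists (fun x => push i c x + - r * d x) => [x xi|x].
    rewrite d0 // mulr0 addr0.
    have [[u e']|] := emb_vP i x; last exact: push_out.
    by rewrite e' push_emb c0 //; apply: contra xi; rewrite e' iP => ->.
  rewrite laplacian_funD laplacian_funZ laplacian_fun_push //.
  under eq_bigr do rewrite qE.
  have kx : k x = k1 x - r * laplacian_fun w d x by rewrite /k1 addrK.
  rewrite kx [k1 x]k1E (eq_push i kE) pushD push_sum.
  by rewrite mulNr addrA.
Qed.

Lemma completely_reducible_kernel_dual_bases (G : bgraph) :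
  completely_reducible G ->
  forall (R : comPzRingType) (w : network G R), kernel_dual_bases w.
Proof.
move: G; apply: completely_reducible_induction.
- by move=> G G0 R w; apply: kernel_dual_bases_empty.
- exact: kernel_dual_bases_point.
- exact: kernel_dual_bases_spike.
- exact: kernel_dual_bases_boundary_edge.
- exact: kernel_dual_bases_disjoint_union.
- exact: kernel_dual_bases_wedge.
Qed.

Lemma kernel_dual_bases_free (G : bgraph) (R : comPzRingType) (w : network G R) :
  kernel_dual_bases w -> free_module (upsilon w).
Proof.
case=> I [b [phi [epsb hphi dual spn]]].
pose bc i : chain G R := [ffun x => b i x].
have bcP i : bc i \in @in_ker_augmentation G R.
  by rewrite unfold_in /augmentation; under eq_bigr do rewrite ffunE; apply/eqP.
pose bk i : ker_augmentation G R := exist _ (bc i) (bcP i).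
pose cls i : upsilon w := quotmod_pi (in_laplacian_interior w) (bk i).
pose q i (k : ker_augmentation G R) := \sum_x phi i x * val k x.
have qL i k k' : quotmod_pi (in_laplacian_interior w) k
    = quotmod_pi (in_laplacian_interior w) k' -> q i k = q i k'.
  move/quotmod_pi_eq => /asboolP[c ic kc].
  apply/eqP; rewrite -subr_eq0 /q -sumrB.
  rewrite (eq_bigr (fun x => phi i x * laplacian_fun w c x)).
    by rewrite harmonic_laplacian //; exact: hphi.
  move=> x _; rewrite -mulrBr; congr (_ * _).
  by rewrite -laplacianE -kc !ffunE.
exists (fun x => exists i, x = cls i); split.
  move=> x; rewrite -[x]quotmod_piK; set k := quotmod_repr x.
  have [|c c0 kE] := spn (val k).
    by have := valP k; rewrite unfold_in => /eqP.
  have -> : quotmod_pi (in_laplacian_interior w) k = \sum_i q i k *: cls i.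
    rewrite /cls -(eq_bigr _ (fun i _ => linearZ_LR _ _ _)) -linear_sum.
    apply/quotmod_pi_eq/asboolP; exists [ffun x => c x].
      by move=> y yi; rewrite ffunE c0.
    apply/ffunP => y; rewrite laplacianE.
    rewrite (eq_laplacian_fun _ (f := c)) => [|z]; last by rewrite ffunE.
    rewrite raddfB raddf_sum !ffunE sum_ffunE kE addrAC -[RHS]add0r; congr (_ + _).
    by apply/eqP; rewrite subr_eq0; apply/eqP; apply: eq_bigr => j _; rewrite !ffunE.
  apply: rpred_sum => i _; apply: rpredZ; apply/asboolP.
  rewrite -[cls i]scale1r -[X in spanned _ X]addr0; apply: spannedD; last exact: spanned0.
  by exists i.
move=> s c us sB cs0 b0 b0s.
have [i b0i] := sB b0 b0s.
have qD k k' r : q i (r *: k + k') = r * q i k + q i k'.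
  rewrite /q mulr_sumr -big_split; apply: eq_bigr => x _ /=.
  by rewrite !ffunE mulrDr mulrCA.
have q_bk j : q i (bk j) = (i == j)%:R.
  by rewrite -dual; apply: eq_bigr => x _; rewrite ffunE.
have q0 : q i 0 = 0 by rewrite /q big1 // => x _; rewrite ffunE mulr0.
have qsum (t : seq (upsilon w)) : q i (\sum_(b <- t) c b *: quotmod_repr b)
    = \sum_(b <- t) c b * q i (quotmod_repr b).
  by elim: t => [|z t IH]; rewrite ?big_nil // !big_cons qD IH.
have : q i (\sum_(b <- s) c b *: quotmod_repr b) = q i 0.
  apply: qL; rewrite linear0 linear_sum -[RHS]cs0.
  by apply: eq_bigr => z _; rewrite linearZ /= quotmod_piK.
rewrite q0 qsum (bigD1_seq b0) //= big_seq_cond big1 ?addr0.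
  have -> : q i (quotmod_repr b0) = q i (bk i) by apply: qL; rewrite quotmod_piK.
  by rewrite q_bk eqxx mulr1.
move=> z /andP[zs zb0]; have [j zj] := sB z zs.
have -> : q i (quotmod_repr z) = q i (bk j) by apply: qL; rewrite quotmod_piK.
have ij : i != j by apply: contraNneq zb0 => ij; rewrite zj b0i ij.
by rewrite q_bk (negbTE ij) mulr0.
Qed.

(** * Networks on a subgraph *)

(** Non-degeneracy of all the networks on [G] with coefficients in a given ring. *)
Definition always_non_degenerate (R : comPzRingType) (G : bgraph) : Prop :=
  forall w : network G R, non_degenerate w.

Section Extend.
Variables (R : comPzRingType) (G1 G : bgraph) (i : embedding G1 G).
Variable w : network G1 R.

(** A network on the source of an embedding extends to its target, with weight 1
    on the other edges. *)
Definition extend_weight (e' : edge G) : R :=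
  if [pick e | emb_e i e == e'] is Some e then w e else 1.

Lemma extend_weight_emb e : extend_weight (emb_e i e) = w e.
Proof.
rewrite /extend_weight; case: pickP => [e1 /eqP/emb_e_inj->//|/(_ e)].
by rewrite eqxx.
Qed.

Lemma extend_weight_out e' : (forall e, e' <> emb_e i e) -> extend_weight e' = 1.
Proof.
by move=> ei; rewrite /extend_weight; case: pickP => [e1 /eqP/esym/ei|].
Qed.

Lemma extend_weight_unit e : exists v, v * extend_weight e = 1.
Proof.
rewrite /extend_weight; case: pickP => [e1 _|_]; first exact: weight_unit.
by exists 1; rewrite mulr1.
Qed.

Lemma extend_weight_rev e : extend_weight (rev e) = extend_weight e.
Proof.
have [[e1 ->]|ei] := emb_eP i e.
  by rewrite emb_rev !extend_weight_emb weight_rev.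
rewrite !extend_weight_out // => e1 re; apply: (ei (rev e1)).
by rewrite -emb_rev -re revK.
Qed.

Definition extend_network : network G R :=
  Network extend_weight_unit extend_weight_rev.

End Extend.

(** A harmonic function on the source that vanishes on its boundary extends by
    zero to a harmonic function on the target. *)
Lemma always_non_degenerate_open (R : comPzRingType) (G1 G : bgraph)
    (i : embedding G1 G) :
  open_embedding i -> always_non_degenerate R G -> always_non_degenerate R G1.
Proof.
move=> io nd w u u0 Lu v.
have u0' x : x \notin interior G1 -> u x = 0 by rewrite -boundaryE; apply: u0.
rewrite -(push_emb i); apply: (nd (extend_network i w)) => {v} x.
  move=> xb; have [[v ev]|] := emb_vP i x; last exact: push_out.
  rewrite ev push_emb u0' //; apply/negP => /io.1; rewrite -ev; apply/negP.
  by rewrite -boundaryE.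
rewrite laplacian_fun_push // /push big1 // => v _; rewrite -[RHS](Lu v).
by apply: eq_bigr => e _; rewrite /= /pull_weight /= extend_weight_emb.
Qed.

Section Subgraph.
Variables (G : bgraph) (S : {set vertex G}) (D : {set edge G}) (I : {set vertex G}).
Hypothesis DS : forall e, e \in D -> org e \in S.
Hypothesis Drev : forall e, e \in D -> rev e \in D.

Lemma sub_dst e : e \in D -> dst e \in S.
Proof. by move=> /Drev/DS; rewrite org_rev. Qed.

(** The subgraph of [G] with vertex set [S], edge set [D] and interior [I]. *)
Definition sub_vertex := {v | v \in S}.
Definition sub_edge := {e | e \in D}.
Definition sub_org (e : sub_edge) : sub_vertex :=
  exist (fun v => v \in S) _ (DS (valP e)).
Definition sub_dst_fun (e : sub_edge) : sub_vertex :=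
  exist (fun v => v \in S) _ (sub_dst (valP e)).
Definition sub_rev (e : sub_edge) : sub_edge :=
  exist (fun e => e \in D) _ (Drev (valP e)).

Lemma sub_revK : involutive sub_rev.
Proof. by move=> e; apply: val_inj; rewrite /= revK. Qed.

Lemma sub_rev_neq e : sub_rev e != e.
Proof. by rewrite -val_eqE /= rev_neq. Qed.

Lemma sub_org_rev e : sub_org (sub_rev e) = sub_dst_fun e.
Proof. by apply: val_inj; rewrite /= org_rev. Qed.

Definition subgraph : bgraph :=
  BGraph [set v : sub_vertex | val v \in I] sub_revK sub_rev_neq sub_org_rev.

Definition sub_embedding : embedding subgraph G :=
  @Embedding subgraph G val val val_inj val_inj
    (fun=> erefl) (fun=> erefl) (fun=> erefl).

Lemma in_sub_interior v : (v \in interior subgraph) = (val v \in I).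
Proof. by rewrite inE. Qed.

Lemma sub_edge_in e' : (exists e, e' = emb_e sub_embedding e) <-> e' \in D.
Proof.
split=> [[e ->]|eD]; first exact: (valP e).
by exists (exist (fun e => e \in D) e' eD).
Qed.

Lemma sub_vertex_in v' : (exists v, v' = emb_v sub_embedding v) <-> v' \in S.
Proof.
split=> [[v ->]|vS]; first exact: (valP v).
by exists (exist (fun v => v \in S) v' vS).
Qed.

Lemma sub_open : I \subset interior G ->
  (forall e, e \notin D -> org e \notin I) -> open_embedding sub_embedding.
Proof.
move=> II DI; split=> [v|e' ei v]; rewrite in_sub_interior.
  by move=> vI; exact: (fintype.subsetP II _ vI).
move=> vi ev; have /DI : e' \notin D by apply/negP => /sub_edge_in[e /ei].
by rewrite ev vi.
Qed.

Lemma card_subgraph :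
  (#|vertex subgraph| + #|edge subgraph| = #|S| + #|D|)%N.
Proof. by rewrite !card_sig. Qed.

End Subgraph.

Section SubSub.
Variables (G : bgraph) (S1 S2 : {set vertex G}) (D1 D2 : {set edge G})
  (I1 I2 : {set vertex G}).
Hypothesis DS1 : forall e, e \in D1 -> org e \in S1.
Hypothesis Drev1 : forall e, e \in D1 -> rev e \in D1.
Hypothesis DS2 : forall e, e \in D2 -> org e \in S2.
Hypothesis Drev2 : forall e, e \in D2 -> rev e \in D2.
Hypothesis S12 : S1 \subset S2.
Hypothesis D12 : D1 \subset D2.

Let H1 := subgraph I1 DS1 Drev1.
Let H2 := subgraph I2 DS2 Drev2.

(** The inclusion of a subgraph into a larger one, as subgraphs of [G]. *)
Definition subsub_vertex (v : vertex H1) : vertex H2 :=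
  exist (fun v => v \in S2) (val v) (fintype.subsetP S12 _ (valP v)).
Definition subsub_edge (e : edge H1) : edge H2 :=
  exist (fun e => e \in D2) (val e) (fintype.subsetP D12 _ (valP e)).

Lemma subsub_vertex_inj : injective subsub_vertex.
Proof. by move=> x y e; apply: val_inj; exact: (congr1 val e). Qed.
Lemma subsub_edge_inj : injective subsub_edge.
Proof. by move=> x y e; apply: val_inj; exact: (congr1 val e). Qed.
Lemma subsub_org e : org (subsub_edge e) = subsub_vertex (org e).
Proof. exact: val_inj. Qed.
Lemma subsub_dst e : dst (subsub_edge e) = subsub_vertex (dst e).
Proof. exact: val_inj. Qed.
Lemma subsub_rev e : rev (subsub_edge e) = subsub_edge (rev e).
Proof. exact: val_inj. Qed.

Definition subsub_embedding : embedding H1 H2 :=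
  Embedding subsub_vertex_inj subsub_edge_inj subsub_org subsub_dst subsub_rev.

End SubSub.

(** * Bridges *)

Section Bridge.
Variable G : bgraph.
Implicit Types (e f z : edge G) (x y v : vertex G).

(** Adjacency after the removal of the undirected edge of [e]. *)
Definition adjacent_off e : rel (vertex G) :=
  fun x y => [exists f, [&& f != e, f != rev e, org f == x & dst f == y]].

(** The ends of [e] are disconnected by the removal of [e]; loops are not bridges. *)
Definition bridge e : bool := ~~ connect (adjacent_off e) (dst e) (org e).

Lemma rev_eq e f : (rev e == f) = (e == rev f).
Proof. by apply/eqP/eqP => [<-|->]; rewrite revK. Qed.

Lemma adjacent_off_sym e : symmetric (adjacent_off e).
Proof.
suff h x y : adjacent_off e x y -> adjacent_off e y x by move=> x y; apply/idP/idP; apply: h.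
case/existsP => f /and4P[fe fr fx fy]; apply/existsP; exists (rev f).
by rewrite !rev_eq fr revK fe org_rev fy dst_rev fx.
Qed.

Lemma adjacent_off_rev e : adjacent_off (rev e) =2 adjacent_off e.
Proof.
move=> x y; apply: eq_existsb => f; rewrite revK.
by rewrite andbCA.
Qed.

Lemma bridge_rev e : bridge (rev e) = bridge e.
Proof.
rewrite /bridge org_rev dst_rev (eq_connect (adjacent_off_rev e)).
by rewrite (sym_connect_sym (@adjacent_off_sym e)).
Qed.

(** [z] and [rev z] are the only edges leaving the side of the bridge [z] that
    contains [dst z]; the statement holds for every edge [z]. *)
Lemma bridge_side z (C := [set v | connect (adjacent_off z) (dst z) v]) f :
  f != z -> f != rev z -> (org f \in C) = (dst f \in C).
Proof.
move=> fz fr.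
have adj : adjacent_off z (org f) (dst f).
  by apply/existsP; exists f; rewrite fz fr !eqxx.
rewrite !inE; apply/idP/idP => h; apply: connect_trans h _; apply: connect1 => //.
by rewrite adjacent_off_sym.
Qed.

(** Adjacency through a bridge. *)
Definition bridge_adjacent : rel (vertex G) :=
  fun x y => [exists f, [&& bridge f, org f == x & dst f == y]].

Lemma bridge_adjacent_sym : symmetric bridge_adjacent.
Proof.
suff h x y : bridge_adjacent x y -> bridge_adjacent y x by move=> x y; apply/idP/idP; apply: h.
case/existsP => f /and3P[fb fx fy]; apply/existsP; exists (rev f).
by rewrite bridge_rev fb org_rev fy dst_rev fx.
Qed.

(** Otherwise a simple path of bridges joins the ends of [e]; the path beyond its
    first edge, followed by [e], avoids that edge and connects its two ends. *)
Lemma not_bridge_connected e : ~~ bridge e -> org e != dst e ->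
  ~~ connect bridge_adjacent (dst e) (org e).
Proof.
move=> nb oe; apply/negP => /connectP[p0 pp0 lp0].
case/shortenP: pp0 lp0 => p pp up _.
case: p pp up => [|b p] /=; first by move=> _ _ /eqP; rewrite (negbTE oe).
case/andP=> /existsP[z /and3P[zb /eqP oz /eqP dz]] pp /and3P[abp _ _] lp.
have zpath : path (adjacent_off z) b p.
  elim: p b {dz lp} pp abp => //= y p IH b /andP[/existsP[f /and3P[fb /eqP of_ /eqP df]] pp].
  rewrite !inE !negb_or => /and3P[ab ay ap].
  rewrite IH // ?inE ?negb_or ?ay // andbT; apply/existsP; exists f.
  rewrite of_ df !eqxx !andbT; apply/andP; split.
    by apply: contraNneq ab => fz; rewrite -of_ fz oz.
  by apply: contraNneq ay => fz; rewrite -df fz dst_rev oz.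
move: (zb); rewrite /bridge oz dz => /negP; apply.
apply: (connect_trans (y := org e)); first by apply/connectP; exists p.
apply: connect1; apply/existsP; exists e; rewrite !eqxx !andbT.
by apply/andP; split; apply: contraNneq nb => ->; rewrite ?bridge_rev.
Qed.

End Bridge.

(** * Flows *)

Section Flow.
Variables (G : bgraph) (R : comPzRingType).
Implicit Types (h : edge G -> R) (e f z : edge G) (x y : vertex G).

(** The antisymmetric function of edges determined by [h].  Working with [h]
    rather than with an arbitrary antisymmetric function makes sums over sets of
    edges closed under reversal cancel without dividing by 2. *)
Definition current h e : R := h e - h (rev e).

(** The current of [h] satisfies the conservation law at every vertex. *)
Definition flow h : Prop := forall x, \sum_(f | org f == x) current h f = 0.

Lemma current_rev h e : current h (rev e) = - current h e.
Proof. by rewrite /current revK opprB. Qed.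

Definition edge_delta e : edge G -> R := fun f => (f == e)%:R.

Lemma sum_current_delta e x :
  \sum_(f | org f == x) current (edge_delta e) f
    = (x == org e)%:R - (x == dst e)%:R.
Proof.
have aux e' : \sum_(f | org f == x) (f == e')%:R = (x == org e')%:R :> R.
  have [->|xe] := eqVneq x (org e').
    rewrite (bigD1 e') //= eqxx big1 ?addr0 // => f /andP[_ /negbTE->//].
  rewrite big1 // => f /eqP fx; case: eqP => // fe.
  by rewrite -fx fe eqxx in xe.
rewrite sumrB aux; congr (_ - _).
under eq_bigr do rewrite /edge_delta rev_eq.
by rewrite aux org_rev.
Qed.

Lemma sum_currentD h k x : \sum_(f | org f == x) current (fun g => h g + k g) f
  = \sum_(f | org f == x) current h f + \sum_(f | org f == x) current k f.
Proof.
by rewrite -big_split; apply: eq_bigr => f _; rewrite /current opprD addrACA.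
Qed.

(** [h] counts the traversals of edges by a walk that avoids [e]; its current has
    its source at [x] and its sink at [y]. *)
Lemma walk_flow e x y : connect (adjacent_off e) x y ->
  exists h, [/\ h e = 0, h (rev e) = 0
    & forall v, \sum_(f | org f == v) current h f = (v == x)%:R - (v == y)%:R].
Proof.
case/connectP => p pp ->; elim: p x pp => [|b p IH] x /=.
  move=> _; exists (fun=> 0); split=> // v.
  by rewrite subrr big1 // => f _; rewrite /current subrr.
case/andP => /existsP[f /and4P[fe fr /eqP fx /eqP fb]] /IH[h [he hr hv]].
exists (fun g => h g + edge_delta f g); rewrite /edge_delta he hr; split.
- by rewrite eq_sym (negbTE fe) addr0.
- by rewrite eq_sym (negbTE fr) addr0.
- move=> v; rewrite sum_currentD hv sum_current_delta fx fb.
  by rewrite addrC addrA subrK.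
Qed.

Lemma cycle_flow e : ~~ bridge e -> exists2 h, flow h & current h e = 1.
Proof.
move/negPn/walk_flow => [h [he hr hv]].
exists (fun g => h g + edge_delta e g).
  by move=> x; rewrite sum_currentD hv sum_current_delta addrC addrA subrK subrr.
by rewrite /current /edge_delta he hr eqxx (negbTE (rev_neq e)) !add0r subr0.
Qed.

(** The total current out of one side of a bridge is zero. *)
Lemma flow_bridge h b : flow h -> bridge b -> current h b = 0.
Proof.
move=> fh bb; pose C := [set v | connect (adjacent_off b) (dst b) v].
have oC : org b \notin C by rewrite inE.
have dC : dst b \in C by rewrite inE connect0.
have : \sum_(x in C) \sum_(f | org f == x) current h f = 0.
  by rewrite big1 // => x _; apply: fh.
rewrite (exchange_big_dep xpredT) //=.
have -> : \sum_f \sum_(x in C | org f == x) current h f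
    = \sum_f (org f \in C)%:R * current h f.
  apply: eq_bigr => f _; have [fC|fC] := boolP (org f \in C).
    rewrite mul1r (big_pred1 (org f)) // => x /=; rewrite andbC eq_sym.
    by case: eqP => //= ->.
  rewrite mul0r big1 // => x /andP[xC /eqP fx]; by rewrite fx xC in fC.
have -> : \sum_f (org f \in C)%:R * current h f =
   \sum_f (org f \in C)%:R * h f - \sum_f (dst f \in C)%:R * h f.
  rewrite -[X in _ - X]sum_edge_rev -sumrB; apply: eq_bigr => f _.
  by rewrite dst_rev mulrBr.
rewrite -sumrB (bigD1 b) //= (bigD1 (rev b)) ?rev_neq //= big1 => [|f /andP[fb fr]].
  rewrite org_rev dst_rev dC (negbTE oC) !mul1r !mul0r sub0r subr0 addr0 => /eqP.
  by rewrite addrC subr_eq0 => /eqP; rewrite /current => ->; rewrite subrr.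
by rewrite (bridge_side fb fr) subrr.
Qed.

End Flow.

Lemma infinite_avoid (F : eqType) (s : seq F) :
  infinite_set [set: F] -> exists x, x \notin s.
Proof.
move=> Finf; apply: contrapT => ns; apply: Finf.
apply: (sub_finite_set (B := [set` s])); last exact: finite_seq.
by move=> x _ /=; apply: contrapT => /negP xs; apply: ns; exists x.
Qed.

Lemma infinite_uniq (F : eqType) (a : F) n : infinite_set [set: F] ->
  exists s : seq F, [/\ uniq s, size s = n & a \notin s].
Proof.
move=> Finf; elim: n => [|n [s [us sn as_]]]; first by exists [::].
have [x] := infinite_avoid (a :: s) Finf; rewrite inE negb_or => /andP[xa xs].
exists (x :: s); rewrite /= us xs sn inE negb_or as_; split=> //.
by rewrite eq_sym xa.
Qed.

Section Degenerate.
Variables (G : bgraph) (F : fieldType).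
Hypothesis Finf : infinite_set [set: F].
Implicit Types (e f : edge G).

Lemma nowhere_zero_flow (s : seq (edge G)) : (forall e, e \in s -> ~~ bridge e) ->
  exists2 h : edge G -> F, flow h & forall e, e \in s -> current h e != 0.
Proof.
elim: s => [|e s IH] sb.
  by exists (fun=> 0) => // x; rewrite big1 // => f _; rewrite /current subrr.
have [|h fh hs] := IH; first by move=> f fs; apply: sb; rewrite inE fs orbT.
have [k fk ke] := cycle_flow F (sb e (mem_head _ _)).
(* For each edge at most one [t] makes the current of [h + t k] vanish. *)
have [t ts] := infinite_avoid [seq - current h f / current k f | f <- e :: s] Finf.
exists (fun g => h g + t * k g) => [x|f fs].
  rewrite sum_currentD fh add0r.
  rewrite (eq_bigr (fun f => t * current k f)) => [|f _]; last by rewrite /current mulrBr.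
  by rewrite -mulr_sumr fk mulr0.
have -> : current (fun g => h g + t * k g) f = current h f + t * current k f.
  by rewrite /current; ring.
have [k0|k0] := eqVneq (current k f) 0.
  rewrite k0 mulr0 addr0; apply: hs; move: fs; rewrite inE => /orP[/eqP fe|//].
  by move: ke; rewrite -fe k0 => /esym/eqP; rewrite oner_eq0.
apply: contraNneq ts => hf; apply/mapP; exists f => //.
apply: (mulIf k0); rewrite mulfVK //.
by apply/eqP; rewrite -addr_eq0 addrC hf eqxx.
Qed.

Hypothesis no_boundary_edge : forall e,
  org e \in boundary G -> dst e \in interior G.
Hypothesis no_boundary_bridge : forall e, bridge e -> org e \in interior G.

(** The potential takes distinct nonzero values on the interior components of the
    graph of bridges, which by hypothesis do not meet the boundary. *)
Lemma generic_potential : exists u : vertex G -> F,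
  [/\ forall x, x \in boundary G -> u x = 0,
      forall x, x \in interior G -> u x != 0,
      forall e, bridge e -> u (org e) = u (dst e)
    & forall e, ~~ bridge e -> org e != dst e -> u (org e) != u (dst e)].
Proof.
have [s [us sn s0]] := infinite_uniq 0 #|vertex G| Finf.
pose lam (v : vertex G) := nth 0 s (enum_rank v).
have szP (v : vertex G) : (enum_rank v < size s)%N by rewrite sn; exact: ltn_ord.
have lamI : injective lam.
  by move=> x y /eqP; rewrite nth_uniq // => /eqP/ord_inj/enum_rank_inj.
have lam0 v : lam v != 0 by apply: contraNneq s0 => <-; apply: mem_nth.
pose u x := if x \in interior G then lam (fingraph.root (@bridge_adjacent G) x) else 0.
have csym := sym_connect_sym (@bridge_adjacent_sym G).
exists u; split.
- by move=> x; rewrite boundaryE /u => /negbTE->.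
- by move=> x xi; rewrite /u xi.
- move=> e be; have oi := no_boundary_bridge be.
  have di : dst e \in interior G by rewrite -org_rev no_boundary_bridge // bridge_rev.
  rewrite /u oi di; congr lam; apply/(fingraph.rootP csym); apply: connect1.
  by apply/existsP; exists e; rewrite be !eqxx.
- move=> e nb oe; rewrite /u.
  have [oi|ob] := boolP (org e \in interior G).
    have [di|db] := boolP (dst e \in interior G); last exact: lam0.
    rewrite (inj_eq lamI) (root_connect csym) csym.
    exact: not_bridge_connected.
  by rewrite no_boundary_edge ?boundaryE // eq_sym lam0.
Qed.

(** Loops carry no constraint since their two orientations contribute opposite
    currents, and the current of a bridge is zero; every other edge gets the
    weight that turns the potential difference into the current. *)
Lemma degenerate_network x0 : x0 \in interior G ->
  ~ always_non_degenerate F G.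
Proof.
move=> x0i nd.
have [u [u0 ui ub unb]] := generic_potential.
have [|h fh hs] := @nowhere_zero_flow (enum [pred e | ~~ bridge e]).
  by move=> e; rewrite mem_enum.
have h0 e : ~~ bridge e -> current h e != 0 by move=> eb; apply: hs; rewrite mem_enum.
pose w e : F := if u (org e) == u (dst e) then 1
  else current h e / (u (org e) - u (dst e)).
have wu e : exists v, v * w e = 1.
  exists (w e)^-1; apply: mulVf; rewrite /w; have [_|ue] := eqVneq (u (org e)) (u (dst e)).
    exact: oner_neq0.
  apply: mulf_neq0; last by rewrite invr_eq0 subr_eq0.
  by apply: h0; apply: contraNN ue => /ub->.
have wr e : w (rev e) = w e.
  rewrite /w org_rev dst_rev eq_sym; case: eqP => // _.
  by rewrite current_rev -[u (dst e) - _]opprB invrN mulrNN.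
have Lu x : laplacian_fun (Network wu wr) u x = 0.
  rewrite /laplacian_fun -[RHS](fh x) (bigID (fun e => dst e == x)) /=.
  rewrite [in RHS](bigID (fun e => dst e == x)) /=; congr (_ + _).
    rewrite big1 => [|e /andP[_ /eqP->]]; last by rewrite subrr mulr0.
    rewrite sumrB [X in _ - X](reindex (@rev G)) /=; last exact/onW_bij/rev_bij.
    rewrite [X in _ - X](eq_bigl (fun f => (org f == x) && (dst f == x))) => [|f]; last first.
      by rewrite org_rev dst_rev andbC.
    by under [X in _ - X]eq_bigr do rewrite revK; rewrite subrr.
  apply: eq_bigr => e /andP[/eqP ox dx]; rewrite -ox /w.
  have [ue|ue] := eqVneq (u (org e)) (u (dst e)).
    rewrite ue subrr mulr0; symmetry; have [be|nbe] := boolP (bridge e).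
      exact: flow_bridge.
    by have := unb e nbe; rewrite ox eq_sym dx -ox ue eqxx => /(_ isT).
  by rewrite mulfVK // subr_eq0.
by have /eqP := nd _ u u0 Lu x0; rewrite (negbTE (ui _ x0i)).
Qed.

End Degenerate.

(** * From non-degeneracy to complete reducibility *)

Lemma remove_boundary_edge (G : bgraph) (e : edge G) :
  org e \in boundary G -> dst e \in boundary G ->
  exists G' : bgraph, [/\ adjoins_boundary_edge G' G,
    exists i : embedding G' G, open_embedding i
    & (#|vertex G'| + #|edge G'| < #|vertex G| + #|edge G|)%N].
Proof.
move=> ob db.
pose D := ~: [set e; rev e].
have DP f : (f \in D) = (f != e) && (f != rev e) by rewrite !inE negb_or.
have DS f : f \in D -> org f \in [set: vertex G] by rewrite inE.
have Dr f : f \in D -> rev f \in D by rewrite !DP !rev_eq revK andbC.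
pose G' := subgraph (interior G) DS Dr.
have vP (v' : vertex G) : exists v : vertex G', v' = emb_v (sub_embedding (interior G) DS Dr) v.
  by apply/sub_vertex_in; rewrite inE.
exists G'; split.
- exists (sub_embedding (interior G) DS Dr), e; split=> //.
  + move=> f; rewrite sub_edge_in DP; split=> [[->|->]|/negP].
    * by rewrite eqxx.
    * by rewrite eqxx andbF.
    * by rewrite negb_and !negbK => /orP[/eqP->|/eqP->]; [left|right].
  + by move=> v; rewrite in_sub_interior.
- exists (sub_embedding (interior G) DS Dr); apply: sub_open => // f.
  rewrite DP negb_and !negbK => /orP[/eqP->|/eqP->]; first by rewrite -boundaryE.
  by rewrite org_rev -boundaryE.
- rewrite card_subgraph -addnS leq_add ?max_card // proper_card //.
  apply/fintype.properP; split; first exact: fintype.subset_predT.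
  by exists e => //; rewrite DP eqxx.
Qed.

(** Let [C] be the side of the bridge [e] that contains its interior end.  [G1] is
    the rest of the graph, which contains [org e], and [G2] consists of [C] and
    [e]; they meet at [org e].  Finally [e] is a spike attached to [G3], which is
    [C] with [dst e] moved to the boundary. *)
Lemma split_boundary_bridge (G : bgraph) (e : edge G) :
  bridge e -> org e \in boundary G -> dst e \in interior G ->
  exists G1 G2 G3 : bgraph,
    [/\ is_boundary_wedge_sum G1 G2 G, adjoins_spike G3 G2,
        (exists i : embedding G1 G, open_embedding i)
        /\ (exists i : embedding G3 G, open_embedding i)
      & (#|vertex G1| + #|edge G1| < #|vertex G| + #|edge G|)%N
        /\ (#|vertex G3| + #|edge G3| < #|vertex G| + #|edge G|)%N].
Proof.
move=> be ob di.
pose C := [set v | connect (adjacent_off e) (dst e) v].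
have oC : org e \notin C by rewrite inE.
have dC : dst e \in C by rewrite inE connect0.
have CP f : f != e -> f != rev e -> (org f \in C) = (dst f \in C).
  exact: bridge_side.
pose D1 := [set f | (org f \notin C) && (dst f \notin C)].
pose D3 := [set f | (org f \in C) && (dst f \in C)].
pose D2 := D3 :|: [set e; rev e].
have D2P f : (f \in D2) = [|| f \in D3, f == e | f == rev e] by rewrite !inE.
have D1P f : (f \in D1) = (org f \notin C) && (dst f \notin C) by rewrite inE.
have D3P f : (f \in D3) = (org f \in C) && (dst f \in C) by rewrite inE.
have eD3 : e \notin D3 by rewrite D3P (negbTE oC).
have reD3 : rev e \notin D3 by rewrite D3P dst_rev (negbTE oC) andbF.
have eD1 : e \notin D1 by rewrite D1P dC andbF.
have reD1 : rev e \notin D1 by rewrite D1P org_rev dC.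
have D1S f : f \in D1 -> org f \in ~: C by rewrite D1P finset.in_setC => /andP[].
have D1r f : f \in D1 -> rev f \in D1 by rewrite !D1P org_rev dst_rev andbC.
have D3S f : f \in D3 -> org f \in C by rewrite D3P => /andP[].
have D3r f : f \in D3 -> rev f \in D3 by rewrite !D3P org_rev dst_rev andbC.
have D2S f : f \in D2 -> org f \in org e |: C.
  rewrite D2P => /or3P[/D3S fC|/eqP->|/eqP->]; rewrite finset.in_setU1 ?fC ?orbT ?eqxx //.
  by rewrite org_rev dC orbT.
have D2r f : f \in D2 -> rev f \in D2.
  rewrite !D2P !rev_eq revK => /or3P[/D3r->//|->|->]; by rewrite !orbT.
pose I1 := interior G :&: ~: C.
pose I2 := interior G :&: C.
pose I3 := I2 :\ dst e.
pose G1 := subgraph I1 D1S D1r.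
pose G2 := subgraph I2 D2S D2r.
pose G3 := subgraph I3 D3S D3r.
pose i1 := sub_embedding I1 D1S D1r : embedding G1 G.
pose i2 := sub_embedding I2 D2S D2r : embedding G2 G.
pose i3 := sub_embedding I3 D3S D3r : embedding G3 G.
have S32 : C \subset org e |: C by apply: finset.subsetUr.
have D32 : D3 \subset D2 by apply: finset.subsetUl.
pose j := subsub_embedding I3 I2 D3S D3r D2S D2r S32 D32 : embedding G3 G2.
have eD2 : e \in D2 by rewrite D2P eqxx orbT.
pose e2 : edge G2 := exist (fun f => f \in D2) e eD2.
have obi : org e \notin interior G by rewrite -boundaryE.
exists G1, G2, G3; split.
- have xC : org e \in ~: C by rewrite finset.in_setC.
  exists (exist (fun v => v \in ~: C) (org e) xC), (org e2), i1, i2; split.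
  + by rewrite !boundaryE !in_sub_interior !finset.in_setI /= (negbTE obi).
  + split=> v; rewrite in_sub_interior finset.in_setI.
      by rewrite (valP v) andbT.
    case: v => v vS /=; move: (vS); rewrite finset.in_setU1 => /orP[/eqP ->|->].
      by rewrite (negbTE obi).
    by rewrite andbT.
  + split=> [v|v1 v2].
      have [vC|vC] := boolP (v \in C); [right|left]; apply/sub_vertex_in.
        by rewrite finset.in_setU1 vC orbT.
      by rewrite finset.in_setC.
    split=> [|[-> ->]//]; case: v1 v2 => [v1 v1C] [v2 v2S] /= e12.
    have v1e : v1 = org e.
      move: (v2S) (v1C); rewrite -e12 finset.in_setU1 finset.in_setC.
      by case/orP => [/eqP//|->].
    by split; apply: val_inj; rewrite /= -?e12.
  + move=> f; have [fD|fD] := boolP (f \in D2); [right|left]; apply/sub_edge_in => //.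
    move: fD; rewrite D2P !negb_or => /and3P[fD fe fr].
    by move: fD; rewrite D3P D1P -(CP f fe fr) !andbb.
  + case=> [f1 f1D] [f2 f2D] /= f12; move: (f2D) (f1D).
    rewrite D2P -f12 => /or3P[|/eqP->|/eqP->].
    * by rewrite D3P D1P => /andP[->].
    * by rewrite (negbTE eD1).
    * by rewrite (negbTE reD1).
- exists j, e2, (exist (fun v => v \in C) (dst e) dC); split.
  + case=> [v vS]; split=> [-> [[u uC] /(congr1 val) /= ou]|nv].
      by move: (uC); rewrite -ou (negbTE oC).
    apply: val_inj => /=; have := vS; rewrite finset.in_setU1 => /orP[/eqP//|vC].
    by case: nv; exists (exist (fun v => v \in C) v vC); apply: val_inj.
  + case=> [f fD2]; split=> [fe [[f0 f0D] /(congr1 val) /= ff]|nf].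
      have : f \notin D3 by case: fe => /(congr1 val) /= ->.
      by rewrite ff f0D.
    have := fD2; rewrite D2P => /or3P[fD|/eqP fe|/eqP fe].
    * by case: nf; exists (exist (fun v => v \in D3) f fD); apply: val_inj.
    * by left; apply: val_inj.
    * by right; apply: val_inj.
  + split; first exact: val_inj.
    by rewrite boundaryE in_sub_interior /I3 finset.in_setD1 eqxx.
  + move=> v; rewrite !in_sub_interior /= finset.in_setD1 -val_eqE /=.
    by have [->|] := eqVneq (val v) (dst e); rewrite ?orbT ?orbF // finset.in_setI di dC.
  + by rewrite boundaryE in_sub_interior finset.in_setI /= (negbTE obi).
- split; [exists i1|exists i3]; apply: sub_open.
  + exact: finset.subsetIl.
  + move=> f fD1; rewrite finset.in_setI finset.in_setC.
    have [->|fe] := eqVneq f e; first by rewrite (negbTE obi).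
    have [->|fr] := eqVneq f (rev e); first by rewrite org_rev dC andbF.
    by move: fD1; rewrite D1P -(CP f fe fr) andbb negbK => ->; rewrite andbF.
  + apply: (fintype.subset_trans (finset.subD1set _ _)); exact: finset.subsetIl.
  + move=> f fD3; rewrite finset.in_setD1 finset.in_setI.
    have [->|fe] := eqVneq f e; first by rewrite (negbTE obi) andbF.
    have [->|fr] := eqVneq f (rev e); first by rewrite org_rev eqxx.
    by move: fD3; rewrite D3P -(CP f fe fr) andbb => /negbTE->; rewrite !andbF.
- rewrite !card_subgraph -!addSn; split; apply: leq_add; rewrite ?max_card //.
    apply: proper_card; apply/fintype.properP; split; first exact: fintype.subset_predT.
    by exists (dst e) => //; rewrite finset.in_setC dC.
  apply: proper_card; apply/fintype.properP; split; first exact: fintype.subset_predT.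
  by exists (org e).
Qed.

Lemma remove_isolated_vertex (G : bgraph) (x : vertex G) :
  interior G = finset.set0 -> (forall e : edge G, False) ->
  exists G' : bgraph, [/\ adjoins_isolated_vertex G' G,
    exists i : embedding G' G, open_embedding i
    & (#|vertex G'| + #|edge G'| < #|vertex G| + #|edge G|)%N].
Proof.
move=> G0 noe.
have DS (f : edge G) : f \in finset.set0 -> org f \in ~: [set x] by case: (noe f).
have Dr (f : edge G) : f \in finset.set0 -> rev f \in finset.set0 by case: (noe f).
pose i := sub_embedding finset.set0 DS Dr.
exists (subgraph finset.set0 DS Dr); split.
- exists i, x; split.
  + move=> v; rewrite sub_vertex_in finset.in_setC finset.in_set1.
    by split=> [->|/negP]; rewrite ?eqxx // negbK => /eqP.
  + by move=> f; case: (noe f).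
  + by move=> v; rewrite in_sub_interior G0 !finset.in_set0.
  + by rewrite boundaryE G0 finset.in_set0.
  + by move=> f; case: (noe f).
- exists i; apply: sub_open; first by rewrite G0.
  by move=> f; case: (noe f).
- rewrite card_subgraph -addSn leq_add ?max_card // proper_card //.
  apply/fintype.properP; split; first exact: fintype.subset_predT.
  by exists x => //; rewrite finset.in_setC finset.in_set1 eqxx.
Qed.

Lemma completely_reducible_step (G G' : bgraph) :
  adjoins_isolated_vertex G G' \/ adjoins_spike G G' \/ adjoins_boundary_edge G G' ->
  completely_reducible G -> completely_reducible G'.
Proof.
move=> h crG; apply: (CR_layerable crG).
exact: layerable_step (layerable_refl _) h.
Qed.

(** The induction carries non-degeneracy over [F] only; it already forces every
    component to meet the boundary. *)
Lemma always_non_degenerate_reducible (F : fieldType) (G : bgraph) :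
  infinite_set [set: F] -> always_non_degenerate F G -> completely_reducible G.
Proof.
move=> Finf; have [n] := ubnP (#|vertex G| + #|edge G|)%N.
elim: n G => // n IH G; rewrite ltnS => Gn nd.
have [[e [ob db]]|nobb] := pselect (exists e : edge G,
    org e \in boundary G /\ dst e \in boundary G).
  have [G' [ext [i io] lt]] := remove_boundary_edge ob db.
  apply: (completely_reducible_step (G := G')); first by right; right.
  by apply: IH (leq_trans lt Gn) _; apply: always_non_degenerate_open io nd.
have bdi (e : edge G) : org e \in boundary G -> dst e \in interior G.
  by move=> ob; apply: contrapT => /negP di; apply: nobb; exists e; rewrite !boundaryE in ob *.
have [[e [be ob]]|nbb] := pselect (exists e : edge G, bridge e /\ org e \in boundary G).
  have [G1 [G2 [G3 [wdg spk [[i1 o1] [i3 o3]] [lt1 lt3]]]]] :=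
    split_boundary_bridge be ob (bdi e ob).
  apply: CR_boundary_wedge_sum wdg.
    by apply: IH (leq_trans lt1 Gn) _; apply: always_non_degenerate_open o1 nd.
  apply: (completely_reducible_step (G := G3)); first by right; left.
  by apply: IH (leq_trans lt3 Gn) _; apply: always_non_degenerate_open o3 nd.
have [G0|[x0 x0i]] := finset.set_0Vmem (interior G); last first.
  case: (degenerate_network Finf bdi _ x0i nd) => e be.
  by apply: contrapT => /negP oi; apply: nbb; exists e; rewrite boundaryE.
have noe (e : edge G) : False.
  have : dst e \in interior G by apply: bdi; rewrite boundaryE G0 finset.in_set0.
  by rewrite G0 finset.in_set0.
have [/CR_empty//|/card_gt0P[x _]] := posnP #|vertex G|.
have [G' [ext [i io] lt]] := remove_isolated_vertex x G0 noe.
apply: (completely_reducible_step (G := G')); first by left.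
by apply: IH (leq_trans lt Gn) _; apply: always_non_degenerate_open io nd.
Qed.

(** * Tensor products and flatness *)

Section Lift.
Variables (R : comNzRingType) (K : choiceType) (T : lmodType R) (g : K -> T).

Lemma fglift_is_zmod_morphism : zmod_morphism (fglift g : {freeg K / R} -> T).
Proof. exact: lift_is_additive. Qed.

HB.instance Definition _ := GRing.isZmodMorphism.Build {freeg K / R} T
  (fglift g) fglift_is_zmod_morphism.

Lemma fglift_is_scalable : scalable (fglift g : {freeg K / R} -> T).
Proof.
have fS (s : seq K) (c : K -> R) : fglift g (\sum_(z <- s) << c z *g z >>)
    = \sum_(z <- s) c z *: g z.
  by rewrite raddf_sum; apply: eq_bigr => z _; exact: liftU.
move=> r x; rewrite -[in RHS](freeg_sumE x) -[r *: x]/(fgscale r x) /fgscale.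
by rewrite !fS scaler_sumr; apply: eq_bigr => z _; rewrite scalerA.
Qed.

HB.instance Definition _ := GRing.isScalable.Build R {freeg K / R} T *:%R
  (fglift g) fglift_is_scalable.

Lemma fglift_sum (x : {freeg K / R}) :
  fglift g x = \sum_(z <- dom x) coeff z x *: g z.
Proof.
by rewrite -{1}(freeg_sumE x) raddf_sum; apply: eq_bigr => z _; exact: liftU.
Qed.

End Lift.

Section Tensor.
Variables (R : comNzRingType) (A M : lmodType R).
Local Notation FG := {freeg (A * M)%type / R}.

Lemma tensor_piB (x y : FG) : tensor_pi (x - y) = tensor_pi x - tensor_pi y.
Proof. exact: linearB. Qed.

Lemma tensor_pi_eq0 (x : FG) :
  tensor_pi x = 0 -> spanned (@tensor_relation R A M) x.
Proof.
have <- : tensor_pi (0 : FG) = 0 by apply: linear0.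
by move/quotmod_pi_eq; rewrite subr0 => /asboolP.
Qed.

(** A map [g] bilinear modulo a submodule [N] is well defined modulo [N] on the
    tensor product. *)
Lemma tensor_lift (T : lmodType R) (g : A -> M -> T) (N : T -> Prop) (x : FG) :
  N 0 -> (forall r y z, N y -> N z -> N (r *: y + z)) ->
  (forall a a' m, N (g (a + a') m - (g a m + g a' m))) ->
  (forall a m m', N (g a (m + m') - (g a m + g a m'))) ->
  (forall r a m, N (g (r *: a) m - r *: g a m)) ->
  (forall r a m, N (g a (r *: m) - r *: g a m)) ->
  tensor_pi x = 0 -> N (fglift (fun p : A * M => g p.1 p.2) x).
Proof.
move=> N0 Nlin gDl gDr gZl gZr /tensor_pi_eq0.
elim=> [|r _ y [a a' m|a m m'|s a m|s a m] _ IH]; first by rewrite linear0.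
all: rewrite linearP; apply: Nlin => //; rewrite linearB.
- by rewrite linearD /= !liftU !scale1r; apply: gDl.
- by rewrite linearD /= !liftU !scale1r; apply: gDr.
- by rewrite linearZ /= !liftU !scale1r; apply: gZl.
- by rewrite linearZ /= !liftU !scale1r; apply: gZr.
Qed.

Let rel_eq (x y : FG) : tensor_relation (x - y) -> tensor_pi x = tensor_pi y.
Proof.
move=> xy; apply/quotmod_pi_eq/asboolP.
rewrite -[X in spanned _ X]scale1r -[X in spanned _ X]addr0.
by apply: spannedD => //; exact: spanned0.
Qed.

Lemma tensor_pureDl (a a' : A) (m : M) :
  tensor_pure (a + a') m = tensor_pure a m + tensor_pure a' m.
Proof. rewrite -[RHS](linearD (quotmod_pi _)); apply: rel_eq; exact: tensor_relDl. Qed.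

Lemma tensor_pureDr (a : A) (m m' : M) :
  tensor_pure a (m + m') = tensor_pure a m + tensor_pure a m'.
Proof. rewrite -[RHS](linearD (quotmod_pi _)); apply: rel_eq; exact: tensor_relDr. Qed.

Lemma tensor_pureZl r (a : A) (m : M) :
  tensor_pure (r *: a) m = r *: tensor_pure a m.
Proof. rewrite -[RHS](linearZ_LR (quotmod_pi _)); apply: rel_eq; exact: tensor_relZl. Qed.

Lemma tensor_pureZr r (a : A) (m : M) :
  tensor_pure a (r *: m) = r *: tensor_pure a m.
Proof. rewrite -[RHS](linearZ_LR (quotmod_pi _)); apply: rel_eq; exact: tensor_relZr. Qed.

Lemma tensor_pure_suml (I : Type) (s : seq I) (r : I -> R) (a : I -> A) (m : M) :
  tensor_pure (\sum_(i <- s) r i *: a i) m = \sum_(i <- s) r i *: tensor_pure (a i) m.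
Proof.
elim: s => [|i s IH]; last by rewrite !big_cons tensor_pureDl tensor_pureZl IH.
by rewrite !big_nil -(scale0r 0) tensor_pureZl scale0r.
Qed.

Lemma tensor_pure_sumr (I : Type) (s : seq I) (r : I -> R) (a : A) (m : I -> M) :
  tensor_pure a (\sum_(i <- s) r i *: m i) = \sum_(i <- s) r i *: tensor_pure a (m i).
Proof.
elim: s => [|i s IH]; last by rewrite !big_cons tensor_pureDr tensor_pureZr IH.
by rewrite !big_nil -(scale0r 0) tensor_pureZr scale0r.
Qed.

Lemma tensor_pi_sum (x : FG) :
  tensor_pi x = \sum_(z <- dom x) coeff z x *: tensor_pure z.1 z.2.
Proof.
rewrite -{1}(freeg_sumE x) /tensor_pi linear_sum; apply: eq_bigr => -[a m] _.
rewrite -(linearZ_LR (quotmod_pi _)); congr quotmod_pi.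
by apply/eqP/freeg_eqP => y; rewrite coeffZ !coeffU mul1r.
Qed.

End Tensor.

Section FreeFlat.
Variables (R : comNzRingType) (M : lmodType R).

(** Every element has a unique expression in a basis, which depends linearly on
    it. *)
Lemma free_coordinates (B : M -> Prop) :
  (forall x, x \in span B) ->
  (forall (s : seq M) (c : M -> R), uniq s -> (forall b, b \in s -> B b) ->
    \sum_(b <- s) c b *: b = 0 -> forall b, b \in s -> c b = 0) ->
  exists sigma : M -> {freeg M / R},
    (forall m, m = \sum_(b <- dom (sigma m)) coeff b (sigma m) *: b) /\
    (forall r m m', sigma (r *: m + m') = r *: sigma m + sigma m').
Proof.
move=> Bspan Bfree.
pose supp (D : {freeg M / R}) := forall z, coeff z D != 0 -> B z.
pose th : {freeg M / R} -> M := fglift id.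
have suppD r D D' : supp D -> supp D' -> supp (r *: D + D').
  move=> sD sD' z; have [zD|/sD//] := eqVneq (coeff z D) 0.
  by rewrite coeffD coeffZ zD mulr0 add0r => /sD'.
have ex m : exists D, supp D /\ th D = m.
  have /asboolP := Bspan m; elim=> [|a x y Bx _ [D [sD tD]]].
    by exists 0; split; [move=> z; rewrite coeff0 eqxx|apply: linear0].
  exists (a *: << x >> + D); split; last by rewrite /th linearP /= liftU scale1r -/(th D) tD.
  apply: suppD => // z; rewrite coeffU mul1r.
  by have [<-|] := eqVneq x z; rewrite ?eqxx.
have un D : supp D -> th D = 0 -> D = 0.
  move=> sD; rewrite /th fglift_sum => D0; apply/eqP; rewrite -dom_eq0.
  case E: (dom D) => [//|z s]; have zD : z \in dom D by rewrite E mem_head.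
  have := Bfree (dom D) (fun z => coeff z D) (uniq_dom D).
  move=> /(_ _ D0 z zD) z0; move: (zD); rewrite mem_dom z0 ?eqxx // => b.
  by rewrite mem_dom => /sD.
have [sigma sP] := choice ex.
exists sigma; split; first by move=> m; rewrite -fglift_sum -/(th _) (sP m).2.
move=> r m m'; apply/eqP; rewrite -subr_eq0; apply/eqP; apply: un.
  rewrite -scaleN1r addrC; apply: (suppD); first apply: (suppD).
  - exact: (sP _).1.
  - exact: (sP _).1.
  - exact: (sP _).1.
rewrite /th linearB linearP /= -!/(th _).
by rewrite !(sP _).2 subrr.
Qed.

Lemma free_flat : free_module M -> flat_module M.
Proof.
case=> B [/free_coordinates h /h{h}[sigma [sE sL]]] A1 A2 f fI.
(* The coordinate along [b] of an element of the tensor product of [A] and [M],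
   as an element of [A]. *)
pose phi (A : lmodType R) b (x : {freeg (A * M)%type / R}) : A :=
  fglift (fun p : A * M => coeff b (sigma p.2) *: p.1) x.
have phi0 (A : lmodType R) b (x : {freeg (A * M)%type / R}) :
    tensor_pi x = 0 -> phi A b x = 0.
  apply: (@tensor_lift _ _ _ _ (fun a m => coeff b (sigma m) *: a) (fun y => y = 0)) => //.
  - by move=> r y z -> ->; rewrite scaler0 addr0.
  - by move=> a a' m; rewrite scalerDr subrr.
  - by move=> a m m'; have := sL 1 m m'; rewrite !scale1r => ->; rewrite coeffD scalerDl subrr.
  - by move=> r a m; rewrite !scalerA mulrC subrr.
  - move=> r a m; have s0 : sigma 0 = 0.
      by have := sL (-1) 0 0; rewrite scaler0 addr0 scaleN1r addNr.
    by rewrite -[r *: m]addr0 sL s0 addr0 coeffZ scalerA subrr.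
have tE (A : lmodType R) (x : {freeg (A * M)%type / R}) :
    (forall b, phi A b x = 0) -> tensor_pi x = 0.
  move=> p0; rewrite tensor_pi_sum.
  pose s := undup (flatten [seq dom (sigma z.2) | z <- dom x]).
  have pE z : z \in dom x -> tensor_pure z.1 z.2
      = \sum_(b <- s) tensor_pure (coeff b (sigma z.2) *: z.1) b.
    move=> zx; rewrite {1}[z.2]sE tensor_pure_sumr.
    have us : uniq s := undup_uniq _.
    rewrite [RHS](bigID (fun b => b \in dom (sigma z.2))) /= [X in _ + X]big1; last first.
      move=> b; rewrite mem_dom negbK => /eqP->.
      by rewrite tensor_pureZl scale0r.
    rewrite addr0 -[RHS]big_filter.
    rewrite [RHS](perm_big (dom (sigma z.2))) /=.
      by apply: eq_bigr => b _; rewrite tensor_pureZl.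
    apply: uniq_perm; rewrite ?filter_uniq ?uniq_dom // => b.
    rewrite mem_filter andbC; case bz : (b \in dom _); rewrite ?andbF // andbT.
    by rewrite mem_undup; apply/flatten_mapP; exists z.
  rewrite big_seq (eq_bigr (fun z => \sum_(b <- s)
    coeff z x *: tensor_pure (coeff b (sigma z.2) *: z.1) b)); last first.
    by move=> z zx; rewrite pE // scaler_sumr.
  rewrite -big_seq exchange_big big1 //= => b _.
  rewrite -tensor_pure_suml -fglift_sum -/(phi A b x) p0.
  by rewrite -(scale0r 0) tensor_pureZl scale0r.
have phif b x : phi A2 b (freeg_map f x) = f (phi A1 b x).
  have -> : freeg_map f x = _ := fglift_sum _ x.
  rewrite /phi [in RHS]fglift_sum !linear_sum /=.
  by apply: eq_bigr => z _; rewrite !linearZ /= liftU scale1r.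
move=> t t' tt.
have tK (u : tensor A1 M) : tensor_pi (tensor_repr u) = u by apply: quotmod_piK.
apply/eqP; rewrite -subr_eq0 -(tK t) -(tK t') -tensor_piB; apply/eqP.
apply: tE => b; apply: fI; rewrite linear0 -phif; apply: phi0.
by rewrite linearB tensor_piB /= -!tensor_mapE !tK tt subrr.
Qed.

End FreeFlat.

Section Ideal.
Variables (S : comNzRingType) (m : submodClosed S^o).

(** An ideal of [S], as a module. *)
Definition ideal_pred : {pred S^o} := fun x => x \in m.
Lemma ideal_pred_closed : submod_closed ideal_pred.
Proof. exact: (GRing.submodClosedP m). Qed.
HB.instance Definition _ := GRing.isSubmodClosed.Build S S^o ideal_pred ideal_pred_closed.

Definition ideal := {x : S^o | x \in ideal_pred}.
HB.instance Definition _ := SubChoice.on ideal.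
HB.instance Definition _ := [SubChoice_isSubZmodule of ideal by <:].
HB.instance Definition _ := [SubZmodule_isSubLmodule of ideal by <:].

Variables (G : bgraph) (w : network G S).

Lemma delta_sub_ker (x a : vertex G) :
  delta S x - delta S a \in @in_ker_augmentation G S.
Proof.
rewrite unfold_in linearB /= /augmentation.
have d1 y : \sum_z delta S y z = 1 :> S.
  rewrite (bigD1 y) //= ffunE eqxx big1 ?addr0 // => z zy.
  by rewrite ffunE (negbTE zy).
by rewrite !d1 subrr.
Qed.

(** If the Laplacian [v] of an interior chain has coefficients in the ideal [m],
    it is also the Laplacian of an interior chain with coefficients in [m]: this
    is the vanishing of Tor_1 of the quotient with S / m, that is, the injectivity
    of the tensor product of the quotient with the inclusion of [m] in [S]. *)
Lemma flat_ideal_laplacian (v c : chain G S) :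
  flat_module (upsilon w) -> interior_chain c -> v = laplacian w c ->
  (forall x, v x \in m) ->
  exists c', [/\ interior_chain c', forall x, c' x \in m & v = laplacian w c'].
Proof.
move=> flat ic vL vm.
have mM (r s : S) : s \in m -> (s * r : S^o) \in m.
  by move=> sm; rewrite mulrC -[r * s]/(r *: (s : S^o)); apply: rpredZ.
have [G0|/card_gt0P[a _]] := posnP #|vertex G|.
  exists 0; split=> [x _|x|]; first by rewrite ffunE.
    by rewrite ffunE rpred0.
  by apply/ffunP => x; have := fintype0 x G0.
(* The Laplacians of the interior chains with coefficients in [m]. *)
pose N z := exists c' : chain G S,
  [/\ interior_chain c', forall x, c' x \in m & z = laplacian w c'].
have N0 : N 0.
  exists 0; split; rewrite ?linear0 // => x; first by rewrite ffunE.
  by rewrite ffunE rpred0.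
have Nlin r y z : N y -> N z -> N (r *: y + z).
  case=> c1 [i1 m1 ->] [c2 [i2 m2 ->]]; exists (r *: c1 + c2); split.
  - by move=> x xi; rewrite !ffunE i1 // i2 // scaler0 addr0.
  - by move=> x; rewrite !ffunE rpredD // rpredZ.
  - by rewrite linearP.
pose pi : ker_augmentation G S -> upsilon w := quotmod_pi (in_laplacian_interior w).
have Npi (s : ideal) k k' : pi k = pi k' -> N (val s *: val k - val s *: val k').
  move/quotmod_pi_eq => /asboolP[c0 ic0 kc0].
  exists (val s *: c0); split.
  - by move=> x xi; rewrite !ffunE ic0 // scaler0.
  - by move=> x; rewrite !ffunE; apply: mM; exact: (valP s).
  - have -> : laplacian w (val s *: c0) = val s *: laplacian w c0 by apply: linearZ.
    by rewrite -kc0 raddfB -scalerBr.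
pose k x : ker_augmentation G S :=
  exist (fun c => c \in @in_ker_augmentation G S) _ (delta_sub_ker x a).
pose vi x : ideal := exist (fun x => x \in ideal_pred) (v x) (vm x).
(* [v] is the combination of the differences [k x] with coefficients in [m]; the
   corresponding tensor becomes zero in S (x) upsilon, because [v] is zero in
   [upsilon]. *)
pose y : {freeg (ideal * upsilon w)%type / S} := \sum_x << (vi x, pi (k x)) >>.
have v0 : \sum_x v x = 0.
  rewrite vL; under eq_bigr do rewrite laplacianE.
  exact: sum_laplacian_fun.
have vE : v = \sum_x v x *: val (k x).
  apply/ffunP => z; rewrite sum_ffunE.
  transitivity (\sum_x (v x * (z == x)%:R - v x * (z == a)%:R)).
    rewrite sumrB -mulr_suml v0 mul0r subr0 (bigD1 z) //= eqxx mulr1 big1 ?addr0 //.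
    by move=> x xz; rewrite eq_sym (negbTE xz) mulr0.
  by apply: eq_bigr => x _; rewrite !ffunE -mulrBr.
have kv0 : \sum_x v x *: pi (k x) = 0.
  have -> : \sum_x v x *: pi (k x) = pi (\sum_x v x *: k x).
    by rewrite /pi linear_sum; apply: eq_bigr => x _; rewrite linearZ.
  have <- : pi 0 = 0 by apply: linear0.
  apply/quotmod_pi_eq/asboolP; exists c => //.
  by rewrite subr0 -vL [RHS]vE raddf_sum.
pose f : {linear ideal -> S^o} := val.
have ty : tensor_pi y = 0.
  apply: (flat _ _ f val_inj).
  have -> : (0 : tensor ideal (upsilon w)) = tensor_pi 0 by apply/esym/linear0.
  rewrite !tensor_mapE linear0 /y linear_sum /tensor_pi linear0 linear_sum.
  transitivity (\sum_x v x *: tensor_pure (1 : S^o) (pi (k x))).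
    apply: eq_bigr => x _; rewrite /= freeg_mapU.
    apply: etrans (tensor_pureZl (v x : S) (1 : S^o) (pi (k x))).
    by rewrite -[_ *: _]/(v x * 1) mulr1.
  by rewrite -tensor_pure_sumr kv0 -(scale0r 0) tensor_pureZr scale0r.
have NE z : z = 0 -> N z by move=> ->.
(* Multiplication of a class by an element of [m] is well defined modulo [N]. *)
pose g (s : ideal) (q : upsilon w) : chain G S := val s *: val (quotmod_repr q).
have H : N (fglift (fun p : ideal * upsilon w => g p.1 p.2) y).
  apply: tensor_lift ty => //; rewrite /g.
  - by move=> s s' q; apply: NE; rewrite /= scalerDl subrr.
  - move=> s q q'; rewrite -scalerDr -raddfD; apply: Npi.
    by rewrite /pi linearD /= !quotmod_piK.
  - by move=> r s q; apply: NE; rewrite /= -scalerA subrr.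
  - move=> r s q; have -> : r *: (val s *: val (quotmod_repr q)) =
        val s *: val (r *: quotmod_repr q) by rewrite /= !scalerA mulrC.
    by apply: Npi; rewrite /pi linearZ /= !quotmod_piK.
move: H; rewrite /y linear_sum /= => H.
have Nsum (I : Type) (s : seq I) (h : I -> chain G S) :
    (forall i, N (h i)) -> N (\sum_(i <- s) h i).
  move=> Nh; elim: s => [|i s IH]; first by rewrite big_nil.
  by rewrite big_cons -[h i]scale1r; apply: Nlin.
suff : N v by [].
have -> : v = 1 *: (\sum_x (v x *: val (k x) - g (vi x) (pi (k x))))
     + \sum_x fglift (fun p : ideal * upsilon w => g p.1 p.2) << (vi x, pi (k x)) >>.
  rewrite scale1r sumrB -vE [X in _ = _ + X](eq_bigr (fun x => g (vi x) (pi (k x)))).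
    by rewrite subrK.
  by move=> x _; rewrite liftU scale1r.
apply: Nlin => //; apply: Nsum => x; apply: (Npi (vi x)).
by rewrite /pi quotmod_piK.
Qed.

End Ideal.

(** * Generic weights are non-degenerate *)

Section Dirichlet.
Variable G : bgraph.

(** The matrix of the Dirichlet problem: Laplacian at interior vertices, value at
    boundary vertices.  The weights need not be units or symmetric, so that the
    matrix can be specialized to weights 0 and 1. *)
Definition dirichlet_mx (R : pzRingType) (t : edge G -> R) : 'M[R]_#|vertex G| :=
  \matrix_(i, j) if enum_val i \in interior G
    then \sum_(e | org e == enum_val i)
           t e * ((enum_val i == enum_val j)%:R - (dst e == enum_val j)%:R)
    else (i == j)%:R.

Lemma map_dirichlet_mx (R S : pzRingType) (phi : {rmorphism R -> S}) (t : edge G -> R) :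
  map_mx phi (dirichlet_mx t) = dirichlet_mx (fun e => phi (t e)).
Proof.
apply/matrixP => i j; rewrite !mxE; case: ifP => _; last by rewrite rmorph_nat.
rewrite rmorph_sum; apply: eq_bigr => e _.
by rewrite rmorphM rmorphB /= !rmorph_nat.
Qed.

Lemma sum_enum_val (R : pzRingType) (u : vertex G -> R) (x : vertex G) :
  \sum_j (x == enum_val j)%:R * u (enum_val (j : 'I_#|vertex G|)) = u x.
Proof.
rewrite (bigD1 (enum_rank x)) //= enum_rankK eqxx mul1r big1 ?addr0 // => j jx.
have /negbTE-> : x != enum_val j.
  by apply: contraNneq jx => ->; rewrite enum_valK.
by rewrite mul0r.
Qed.

Lemma mul_dirichlet_mx (R : pzRingType) (t : edge G -> R) (u : vertex G -> R) i :
  (dirichlet_mx t *m (\col_j u (enum_val j))) i ord0 =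
  if enum_val i \in interior G
  then \sum_(e | org e == enum_val i) t e * (u (enum_val i) - u (dst e))
  else u (enum_val i).
Proof.
rewrite mxE; case: ifP => ii.
  transitivity (\sum_(j < #|vertex G|) \sum_(e | org e == enum_val i)
      t e * (((enum_val i == enum_val j)%:R - (dst e == enum_val j)%:R) * u (enum_val j))).
    by apply: eq_bigr => j _; rewrite !mxE ii mulr_suml; apply: eq_bigr => e _; rewrite mulrA.
  rewrite exchange_big; apply: eq_bigr => e _ /=.
  rewrite -mulr_sumr; congr (_ * _).
  under eq_bigr do rewrite mulrBl.
  by rewrite sumrB !sum_enum_val.
rewrite -[RHS]sum_enum_val; apply: eq_bigr => j _.
by rewrite !mxE ii (inj_eq enum_val_inj).
Qed.

(** Uniqueness for the Dirichlet problem with edge weights [t]. *)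
Definition dirichlet_unique (R : pzRingType) (t : edge G -> R) : Prop :=
  forall u : vertex G -> R,
    (forall x, x \in boundary G -> u x = 0) ->
    (forall x, x \in interior G ->
      \sum_(e | org e == x) t e * (u x - u (dst e)) = 0) ->
    forall x, u x = 0.

Lemma det_dirichlet_mx (F : fieldType) (t : edge G -> F) :
  dirichlet_unique t <-> \det (dirichlet_mx t) != 0.
Proof.
split=> [du|d0 u u0 Lu x].
  apply/negP; rewrite -det_tr => /det0P[v v0 vD]; case/eqP: v0.
  pose u x := v ord0 (enum_rank x).
  have vE : v^T = \col_j u (enum_val j).
    by apply/matrixP => i j; rewrite !mxE /u enum_valK (ord1 j).
  have Du : dirichlet_mx t *m (\col_j u (enum_val j)) = 0.
    by rewrite -vE -[dirichlet_mx t]trmxK -trmx_mul vD trmx0.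
  have Du' x : (if x \in interior G
      then \sum_(e | org e == x) t e * (u x - u (dst e)) else u x) = 0.
    have := congr1 (fun m : 'cV__ => m (enum_rank x) ord0) Du.
    by rewrite mul_dirichlet_mx mxE enum_rankK.
  have u0 : forall x, u x = 0.
    apply: du => x xb; last by have := Du' x; rewrite xb.
    by rewrite boundaryE in xb; have := Du' x; rewrite (negbTE xb).
  by apply/matrixP => i j; rewrite (ord1 i) mxE -[RHS](u0 (enum_val j)) /u enum_valK.
have Du : dirichlet_mx t *m (\col_j u (enum_val j)) = 0.
  apply/matrixP => i j; rewrite (ord1 j) mul_dirichlet_mx [RHS]mxE.
  by case: ifP => ii; [apply: Lu|apply: u0; rewrite boundaryE ii].
have /mulKmx /(_ (\col_j u (enum_val j))) : dirichlet_mx t \in unitmx.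
  by rewrite unitmxE unitfE.
rewrite Du mulmx0 => /(congr1 (fun m : 'cV__ => m (enum_rank x) ord0)).
by rewrite !mxE enum_rankK.
Qed.

Hypothesis hG : components_meet_boundary G.

(** Obtained with [d] the distance to the boundary, and [f x] the first edge of a
    shortest path from the interior vertex [x] to the boundary. *)
Lemma rooted_forest : exists (d : vertex G -> nat) (f : vertex G -> option (edge G)),
  forall x, if f x is Some e
            then [/\ x \in interior G, org e = x & (d (dst e) < d x)%N]
            else x \notin interior G.
Proof.
pose reach x n := `[< exists p, [/\ path (@adjacent G) x p, size p = n
  & last x p \in boundary G] >].
have ex x : exists n, reach x n.
  have [y yb /connectP[p pp lp]] := hG x.
  by exists (size p); apply/asboolP; exists p; rewrite -lp.
pose d x := ex_minn (ex x).
suff /choice[f fP] x : exists o : option (edge G), if o is Some e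
    then [/\ x \in interior G, org e = x & (d (dst e) < d x)%N]
    else x \notin interior G.
  by exists d, f.
have [xi|xb] := boolP (x \in interior G); last by exists None.
rewrite {2}/d; case: ex_minnP => n /asboolP[[|y p] [/= pp sp lp] _].
  by rewrite boundaryE xi in lp.
case/andP: pp => /existsP[e /andP[/eqP oe /eqP de]] pp.
exists (Some e); split=> //; rewrite -sp ltnS /d.
case: ex_minnP => m _; apply; apply/asboolP; exists p.
by rewrite de.
Qed.

(** With weight 1 on a rooted forest and 0 elsewhere, a solution is constant along
    the edges of the forest, starting with the vertices farthest from the roots;
    its values are thus those at the roots, zero. *)
Lemma forest_dirichlet_unique (F : fieldType) : exists T : {set edge G},
  dirichlet_unique (fun e => ((e \in T) || (rev e \in T))%:R : F).
Proof.
have [d [f fP]] := rooted_forest.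
exists [set e | f (org e) == Some e] => u u0 Lu.
pose N := \max_x d x.
have step x e : f x = Some e -> u x = u (dst e).
  have [n] : exists n, (N < d x + n)%N by exists N.+1; rewrite addnS ltnS leq_addl.
  elim: n x e => [|n IH] x e Nx fx.
    by move: Nx; rewrite addn0 ltnNge leq_bigmax.
  have := fP x; rewrite fx => -[xi oe de].
  have := Lu x xi; rewrite (bigD1 e) /=; last by rewrite oe.
  rewrite inE oe fx eqxx mul1r big1 ?addr0.
    by move/eqP; rewrite subr_eq0 => /eqP.
  move=> e' /andP[/eqP oe' ee']; rewrite !inE oe' fx.
  have /negbTE-> : Some e != Some e' by apply: contraNneq ee' => -[->].
  rewrite org_rev; case: eqP => [fe'|]; last by rewrite mul0r.
  have := fP (dst e'); rewrite fe' dst_rev oe' => -[_ _ dx].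
  rewrite (IH _ _ _ fe') ?dst_rev ?oe' ?subrr ?mulr0 //.
  by apply: leq_trans Nx _; rewrite addnS -addSn leq_add2r.
move=> x; have [n] := ubnP (d x); elim: n x => // n IH x xn.
have := fP x; case E: (f x) => [e|] => [[_ oe de]|xb]; last by apply: u0; rewrite boundaryE.
by rewrite (step x e E) IH // (leq_trans de).
Qed.

End Dirichlet.

Lemma laurent_valMB (F : fieldType) n (p q r : laurent F n) :
  val (p * (q - r)) = val p * (val q - val r).
Proof. by rewrite rmorphM rmorphB. Qed.

Section Laurent.
Variables (G : bgraph) (F : fieldType).

(** The index of the variable t_e of the Laurent ring. *)
Definition uedge_index (e : edge G) : 'I_#|uedges G| :=
  enum_rank_in (uedge_in e) (uedge e).

Lemma uedge_eq (e f : edge G) : uedge e = uedge f -> e = f \/ e = rev f.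
Proof.
move=> ef; have : e \in uedge f by rewrite -ef !inE eqxx.
by rewrite !inE => /orP[/eqP->|/eqP->]; [left|right].
Qed.

Lemma laurent_non_degenerate : components_meet_boundary G ->
  non_degenerate (laurent_network F G).
Proof.
move=> hG u u0 Lu x; apply: val_inj => /=.
pose X e : {mpoly F[#|uedges G|]} := 'X_(uedge_index e).
have [T Tu] := forest_dirichlet_unique hG F.
(* The point at which the weights are the indicator function of the forest. *)
pose a (i : 'I_#|uedges G|) : F :=
  [exists e, (enum_val i == uedge e) && (e \in T)]%:R.
have aE e : a (uedge_index e) = ((e \in T) || (rev e \in T))%:R.
  rewrite /a enum_rankK_in ?uedge_in //; congr (_ %:R); congr nat_of_bool.
  apply/existsP/orP => [[f /andP[/eqP/uedge_eq[->|->] fT]]|[eT|eT]].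
  - by left.
  - by right; rewrite revK.
  - by exists e; rewrite eqxx.
  - by exists (rev e); rewrite eT andbT /uedge revK finset.setUC.
have detX : \det (dirichlet_mx X) != 0.
  have /det_dirichlet_mx : dirichlet_unique (fun e => meval a (X e)).
    move=> v v0 Lv; apply: Tu => // y yi; rewrite -[RHS](Lv y yi).
    by apply: eq_bigr => e _; rewrite mevalXU aE.
  rewrite -(map_dirichlet_mx (meval a)) det_map_mx.
  by apply: contraNneq => ->; rewrite rmorph0.
have /det_dirichlet_mx du : \det (dirichlet_mx (fun e => FracField.tofrac (X e))) != 0.
  by rewrite -(map_dirichlet_mx (@FracField.tofrac _)) det_map_mx tofrac_eq0.
apply: (du (fun y => val (u y))) => [y yb|y yi]; first by rewrite u0.
have := congr1 val (Lu y); rewrite /laplacian_fun raddf_sum => LuE.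
rewrite -[RHS]LuE; apply: eq_bigr => e _.
exact/esym/laurent_valMB.
Qed.

End Laurent.

(** * Flatness implies non-degeneracy *)

Section Vanishing.
Variables (F : fieldType) (n : nat) (a : 'I_n -> F).
Local Notation S := (laurent F n).
Local Notation tf := (@FracField.tofrac {mpoly F[n]}).

(** The ideal of the Laurent polynomials that vanish at the point [a], provided the
    coordinates of [a] are nonzero. *)
Definition vanishing : {pred S^o} := fun x =>
  `[< exists p k, val (x : S) = tf p / tf 'X_[k] /\ p.@[a] = 0 >].

Lemma vanishing_closed : submod_closed vanishing.
Proof.
split=> [|c x y /asboolP[p [k [xE p0]]] /asboolP[q [l [yE q0]]]]; apply/asboolP.
  by exists 0, 0%MM; rewrite meval0 rmorph0 mul0r.
have /asboolP[r [j cE]] := valP (c : S).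
exists (r * p * 'X_[l] + q * 'X_[(j + k)%MM]), (j + k + l)%MM; split; last first.
  by rewrite mevalD !mevalM p0 q0 mulr0 !mul0r addr0.
have -> : val (c *: x + y : S) = val c * val (x : S) + val (y : S) by rewrite rmorphD rmorphM.
rewrite cE xE yE mulf_div -tofracM -tofracM -mpolyXD.
by rewrite addf_div ?mpolyX_frac_neq0 // -!tofracM -tofracD -mpolyXD.
Qed.

HB.instance Definition _ := GRing.isSubmodClosed.Build S S^o vanishing vanishing_closed.

Lemma laurent_const_subproof (c : F) : tf c%:MP \in @is_laurent F n.
Proof. by apply/asboolP; exists c%:MP, 0%MM; rewrite mpolyX0 tofrac1 divr1. Qed.

(** The constant Laurent polynomial [c]. *)
Definition laurent_const (c : F) : S :=
  exist (fun x => x \in @is_laurent F n) _ (laurent_const_subproof c).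

Lemma laurent_const_vanishing (c : F) : (forall i, a i != 0) ->
  laurent_const c \in vanishing -> c = 0.
Proof.
move=> a0 /asboolP[p [k [/= cE p0]]].
have : tf c%:MP * tf 'X_[k] = tf p by rewrite cE divfK // mpolyX_frac_neq0.
rewrite -tofracM => /eqP; rewrite tofrac_eq => /eqP/(congr1 (meval a)).
rewrite mevalM mevalC p0 mevalX => /eqP; rewrite mulf_eq0 => /orP[/eqP//|].
by move=> /prodf_eq0[i _]; rewrite expf_eq0 (negbTE (a0 i)) andbF.
Qed.

End Vanishing.

Lemma flat_laurent_non_degenerate (G : bgraph) (F : fieldType) :
  components_meet_boundary G -> flat_module (upsilon (laurent_network F G)) ->
  always_non_degenerate F G.
Proof.
move=> hG flat w u u0 Lu x.
have exa i : exists c : F, forall e, uedge_index e = i -> w e = c.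
  have [[e ei]|ne] := pselect (exists e, uedge_index e = i); last first.
    by exists 0 => e ei; case: ne; exists e.
  exists (w e) => f; rewrite -ei => /(congr1 enum_val).
  by rewrite !enum_rankK_in ?uedge_in // => /uedge_eq[->//|->]; rewrite weight_rev.
have [a aP] := choice exa.
have aw e : a (uedge_index e) = w e by rewrite -(aP _ e).
have a0 i : a i != 0.
  have /imsetP[e _ ei] := enum_valP i.
  have -> : i = uedge_index e.
    by apply: enum_val_inj; rewrite enum_rankK_in ?uedge_in.
  rewrite aw; have [v vw] := weight_unit w e.
  by apply: contra_eq_neq vw => ->; rewrite mulr0 eq_sym oner_neq0.
pose c : chain G (laurent_ring F G) := [ffun y => laurent_const _ (u y)].
have ic : interior_chain c.
  move=> y yi; rewrite ffunE u0 ?boundaryE //; apply: val_inj => /=.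
  by rewrite mpolyC0 tofrac0.
have Lm y : laplacian (laurent_network F G) c y \in vanishing a.
  rewrite laplacianE; apply/asboolP.
  exists (\sum_(e | org e == y) 'X_(uedge_index e) * ((u y)%:MP - (u (dst e))%:MP)), 0%MM.
  split.
    rewrite mpolyX0 tofrac1 divr1 rmorph_sum raddf_sum; apply: eq_bigr => e _.
    rewrite !ffunE; apply: etrans (laurent_valMB _ _ _) _.
    by rewrite /= tofracM tofracB.
  rewrite -[RHS](Lu y) raddf_sum; apply: eq_bigr => e _.
  by rewrite /= mevalM mevalB !mevalC mevalXU aw.
have [c' [ic' c'm LE]] := flat_ideal_laplacian flat ic erefl Lm.
have cc' : c = c' := laplacian_interior_inj (@laurent_non_degenerate G F hG) ic ic' LE.
apply: (laurent_const_vanishing a0).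
by have := c'm x; rewrite -cc' ffunE.
Qed.

Theorem theorem7p13 (G : bgraph) (hG : components_meet_boundary G) :
  [<-> completely_reducible G;
       forall (R : comPzRingType) (w : network G R), non_degenerate w;
       forall (R : comPzRingType) (w : network G R),
         non_degenerate w -> free_module (upsilon w);
       exists2 F : fieldType, infinite_set [set: F]
         & flat_module (upsilon (laurent_network F G));
       exists2 F : fieldType, infinite_set [set: F]
         & forall w : network G F, non_degenerate w].
Proof.
tfae.
- by move=> crG R w; apply: completely_reducible_non_degenerate.
- move=> nd R w _; apply: kernel_dual_bases_free.
  apply: completely_reducible_kernel_dual_bases.
  by apply: (always_non_degenerate_reducible infinite_rat) => w'; apply: nd.
- move=> free; exists rat; first exact: infinite_rat.
  by apply: free_flat; apply: free; apply: laurent_non_degenerate.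
- by move=> [F Finf flat]; exists F => //; apply: flat_laurent_non_degenerate.
- by move=> [F Finf nd]; apply: always_non_degenerate_reducible Finf _.
Qed.
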